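(* Let $\Gamma_\theta$ be a symmetric positive definite $p\times p$ matrix, $\Upsilon$ a $p\times r$ matrix of full rank $r<p$, and $\tau\in\mathbb{R}^p$. Put $P_{\Upsilon,{\rm eff}}:=\Gamma_\theta^{1/2}\Upsilon(\Upsilon'\Gamma_\theta\Upsilon)^{-1}\Upsilon'\Gamma_\theta^{1/2}$ and $P^{\perp}_{\Upsilon,{\rm eff}}:=I_p-P_{\Upsilon,{\rm eff}}$. Let $D$ be a random $p$-vector that is normal with mean vector $P^{\perp}_{\Upsilon,{\rm eff}}\Gamma_\theta^{1/2}\tau$ and covariance matrix $P^{\perp}_{\Upsilon,{\rm eff}}$, and let $$\mu^{\rm Vic}_{\rm PTE,eff}:=\Gamma_\theta^{-1/2}P^{\perp}_{\Upsilon,{\rm eff}}\left\{(1-\lambda(\|D\|^2))D-\Gamma_\theta^{1/2}\tau\right\}.$$ Then $${\rm E}[\mu^{\rm Vic}_{\rm PTE,eff}]=-\gamma_2\,\Gamma_\theta^{-1/2}P^{\perp}_{\Upsilon,{\rm eff}}\Gamma_\theta^{1/2}\tau$$ and $${\rm Var}[\mu^{\rm Vic}_{\rm PTE,eff}]=(1-\gamma_2)\,\Gamma_\theta^{-1/2}P^{\perp}_{\Upsilon,{\rm eff}}\Gamma_\theta^{-1/2}+\left((1-\gamma_4)-(1-\gamma_2)^2\right)\Gamma_\theta^{-1/2}P^{\perp}_{\Upsilon,{\rm eff}}\Gamma_\theta^{1/2}\tau\tau'\Gamma_\theta^{1/2}P^{\perp}_{\Upsilon,{\rm eff}}\Gamma_\theta^{-1/2},$$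 where $\gamma_j:={\rm P}[V_j\le\chi^2_{p-r,1-\alpha}]$ with $V_j\sim\chi^2_{p-r+j}\left(\tau'\Gamma_\theta^{1/2}P^{\perp}_{\Upsilon,{\rm eff}}\Gamma_\theta^{1/2}\tau\right)$, for $j=2,4$.
   Context: A prime denotes transposition, $\|\cdot\|$ is the Euclidean norm, $I_p$ is the $p\times p$ identity matrix, $\Gamma_\theta^{1/2}$ is the symmetric positive definite square root and $\Gamma_\theta^{-1/2}$ its inverse. ($\Gamma_\theta$ is the information matrix of a uniformly locally asymptotically normal model at a parameter value $\theta$.) $\alpha\in[0,1]$ is the nominal level; $\chi^2_{\ell,\beta}$ denotes the quantile of order $\beta$ of the $\chi^2_\ell$ distribution (the probability of being $\le\chi^2_{\ell,\beta}$ is $\beta$, with $\chi^2_{\ell,0}=0$ and $\chi^2_{\ell,1}=+\infty$). $\lambda(v):=\mathbb{I}[v\le\chi^2_{p-r,1-\alpha}]$, where $\mathbb{I}$ is the indicator function. $\chi^2_\ell(\eta)$ is the non-central chi-square distribution with $\ell$ degrees of freedom and non-centrality parameter $\eta$, i.e. the distribution of $\|X\|^2$ for $X$ normal in $\mathbb{R}^\ell$ with identity covariance and mean vector $m$ with $\|m\|^2=\eta$. ${\rm Var}$ of a random vector denotes its covariance matrix. *)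

(* Defs.v *)
From HB Require Import structures.
From mathcomp Require Import all_boot all_order all_algebra.
From mathcomp Require Import all_classical all_reals all_analysis.
From mathcomp Require Import measurable_realfun.

Set Implicit Arguments.
Unset Strict Implicit.
Unset Printing Implicit Defensive.

Import Order.TTheory GRing.Theory Num.Theory.
Import numFieldNormedType.Exports.

Local Open Scope classical_set_scope.
Local Open Scope ring_scope.

Definition mx_display : measure_display -> measure_display.
Proof. exact. Qed.

Section measurable_matrix.
Context {d} {T : measurableType d} (m n : nat).

Definition mx_cylinder : set (set 'M[T]_(m, n)) :=
  [set C | exists i j (B : set T),
     measurable B /\ C = (fun M : 'M[T]_(m, n) => M i j) @^-1` B].

(* Over a [realType] this is the Borel sigma-algebra of the matrix space. *)
HB.instance Definition _ := @isMeasurable.Build (mx_display d) 'M[T]_(m, n)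
  <<s mx_cylinder >> (@sigma_algebra0 _ setT mx_cylinder)
  (@sigma_algebraC _ mx_cylinder) (@sigma_algebra_bigcup _ setT mx_cylinder).

Lemma measurable_mx_coor (i : 'I_m) (j : 'I_n) :
  measurable_fun [set: 'M[T]_(m, n)] (fun M : 'M[T]_(m, n) => M i j).
Proof.
by move=> _ B mB; rewrite setTI; apply: sub_sigma_algebra; exists i, j, B.
Qed.

Lemma measurable_fun_mxP d' (S : measurableType d') (f : S -> 'M[T]_(m, n)) :
  measurable_fun setT f <-> forall i j, measurable_fun setT (fun x => f x i j).
Proof.
split=> [mf i j|mf].
  exact: (measurableT_comp (measurable_mx_coor i j) mf).
apply: (@measurability _ _ _ _ setT f mx_cylinder) => // _ [_ [i [j [B [mB ->]]]] <-].
by rewrite -comp_preimage; apply: mf.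
Qed.

End measurable_matrix.

Section normal_laws.
Context {R : realType}.

(* The squared Euclidean norm; the library norm on matrices is the sup norm. *)
Definition sqnorm n (x : 'cV[R]_n) : R := \sum_i x i 0 ^+ 2.

Lemma measurable_sqnorm n : measurable_fun setT (@sqnorm n).
Proof.
apply: measurable_sum => i; apply: (measurable_funX 2).
exact: measurable_mx_coor.
Qed.

HB.instance Definition _ n := isMeasurableFun.Build _ _ _ _ (@sqnorm n)
  (@measurable_sqnorm n).

(* [measurableTypeR R] is the carrier of [normal_prob]; it has the same measurable
   sets as [R]. *)
Definition consv n (xv : measurableTypeR R * 'cV[R]_n) : 'cV[R]_n.+1 :=
  \col_i if unlift ord0 i is Some j then xv.2 j 0 else xv.1.

Lemma measurable_consv n : measurable_fun setT (@consv n).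
Proof.
apply/measurable_fun_mxP => i j.
under eq_fun do rewrite mxE.
case: unliftP => [k|] _; last exact: measurable_fst.
exact: (measurableT_comp (measurable_mx_coor k 0) measurable_snd).
Qed.

HB.instance Definition _ n := isMeasurableFun.Build _ _ _ _ (@consv n)
  (@measurable_consv n).

(* The law of a vector with [n] independent N(0, 1) entries, i.e. the [n]-fold
   product of [normal_prob 0 1]. *)
Fixpoint std_normal n : probability 'cV[R]_n R :=
  match n with
  | 0 => \d_(0 : 'cV[R]_0)
  | n'.+1 => distribution (normal_prob 0 1 \x std_normal n')%E (@consv n')
  end.

(* [Sigma] may be singular.  Laws are only compared on measurable sets: a
   [probability] is a function on all sets, arbitrary on the others. *)
Definition normal_law n (m : 'cV[R]_n) (Sigma : 'M[R]_n)
    (mu : probability 'cV[R]_n R) : Prop :=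
  exists k (A : 'M[R]_(n, k)), A *m A^T = Sigma /\
    forall B, measurable B ->
      mu B = std_normal k ((fun z => m + A *m z) @^-1` B).

Definition noncentral_chi2_law (l : nat) (eta : R) (nu : probability R R) : Prop :=
  exists (m : 'cV[R]_l) (mu : probability 'cV[R]_l R),
    [/\ normal_law m 1%:M mu, sqnorm m = eta &
     forall B, measurable B -> nu B = distribution mu (@sqnorm l) B].

Definition chi2_cdf (l : nat) (x : R) : \bar R :=
  cdf (@sqnorm l : {RV (std_normal l) >-> R}) x.

(* For [0 < l], the restriction to [0 <= x] gives the value 0 at [beta = 0], and
   the set is empty, hence the value +oo, at [beta = 1]. *)
Definition chi2_quantile (l : nat) (beta : R) : \bar R :=
  ereal_inf [set x%:E | x in [set x : R | 0 <= x /\ (beta%:E <= chi2_cdf l x)%E]].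

End normal_laws.

Section moments.
Context d {T : measurableType d} {R : realType} (P : probability T R).

(* The entries are extended reals: an equality with a real vector or matrix
   includes the existence of the moments. *)
Definition mean_vector n (X : T -> 'cV[R]_n) : 'cV[\bar R]_n :=
  \col_i expectation P (fun w => X w i 0).

Definition covariance_matrix n (X : T -> 'cV[R]_n) : 'M[\bar R]_n :=
  \matrix_(i, j) covariance P (fun w => X w i 0) (fun w => X w j 0).

End moments.

Section estimator.
Context {R : realType}.

Definition posdefmx n (A : 'M[R]_n) : Prop :=
  A^T = A /\ forall v : 'cV[R]_n, v != 0 -> 0 < (v^T *m A *m v) 0 0.

Definition posdef_sqrt n (A S : 'M[R]_n) : Prop := posdefmx S /\ S *m S = A.

(* In the definitions below [S] stands for the square root of [Gamma]. *)
Definition Peff p r (Gamma S : 'M[R]_p) (Upsilon : 'M[R]_(p, r)) : 'M[R]_p :=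
  S *m Upsilon *m invmx (Upsilon^T *m Gamma *m Upsilon) *m Upsilon^T *m S.

Definition Peff_perp p r (Gamma S : 'M[R]_p) (Upsilon : 'M[R]_(p, r)) : 'M[R]_p :=
  1%:M - Peff Gamma S Upsilon.

Definition pretest_indicator (l : nat) (alpha v : R) : R :=
  (v%:E <= chi2_quantile l (1 - alpha))%E%:R.

Definition mu_PTE_eff p r (alpha : R) (Gamma S : 'M[R]_p)
    (Upsilon : 'M[R]_(p, r)) (tau D : 'cV[R]_p) : 'cV[R]_p :=
  invmx S *m Peff_perp Gamma S Upsilon *m
    ((1 - pretest_indicator (p - r) alpha (sqnorm D)) *: D - S *m tau).

End estimator.

(* Main.v *)
From HB Require Import structures.
Require Import Defs.
From mathcomp Require Import all_boot all_order all_algebra.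
From mathcomp Require Import all_classical all_reals all_analysis.
From mathcomp Require Import measurable_realfun.
From mathcomp Require Import ring lra.

(** The random vector [D] is [m + A z] with [z] standard normal, and both its
    mean and the range of its covariance lie in the range of the projection
    [Q = Peff_perp].  Writing [Q = U U^T] with [U^T U = 1], where [U] has
    [l = p - r] columns, one gets [D = U X] in law, with [X] normal in
    dimension [l], of identity covariance and mean [theta = U^T S tau].
    Since [U] is an isometry the pretest compares [|X|^2] with the critical
    value [c], and every coordinate of the estimator is a constant plus
    [(1 - 1[|X|^2 <= c]) <a, X>] for some vector [a].  Everything thus follows
    from

      E[1[|X|^2 <= c] <a, X>]   = <a, theta> P(chi2_(l+2) <= c),
      E[1[|X|^2 <= c] <a, X>^2] = |a|^2 P(chi2_(l+2) <= c)
                                  + <a, theta>^2 P(chi2_(l+4) <= c),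

    with noncentrality [|theta|^2] on the right, by polarization and by
    subtraction from the full moments of [X] ([tail_moments]).

    Both identities are instances of one integration by parts
    ([stein_two_more_dimensions]): for [d = <a, X>] with [|a| = 1],
    [t = <a, theta>] and [psi] affine,

      E[1[|X|^2 <= c] d psi(d)] = E[1[|X|^2 + W <= c] (psi'(d) + t psi(d))]

    where [W] is an independent chi-square variable with two degrees of
    freedom.  On the right [|X|^2 + W] is the squared norm of a normal vector
    with two more coordinates, centred; this is why the degrees of freedom go
    up by two, and by four when the identity is used twice.  After integrating
    [W] out, the identity says that the derivative of
    [psi(x) phi(x - t) (1 - exp ((x^2 - c) / 2))], with [phi] the standard
    normal density, has integral zero over [[- sqrt c, sqrt c]]: this function
    vanishes at both ends ([normal_stein_chi2]).  That [W] has distribution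
    function [1 - exp (- s / 2)] comes from the substitution [y = x u] in the
    planar Gaussian integral ([normal2_disk]).

    Reductions to coordinates rest on the invariance of the standard normal
    law under rotations, in the form: [B z] is standard normal whenever the
    rows of [B] are orthonormal ([std_normal_orthonormal_rows]).  In the plane
    it follows from affine substitutions, one variable at a time
    ([gauss2_rotation]); in general, a unit vector is carried to the first
    axis by successive planar rotations. *)

Set Implicit Arguments.
Unset Strict Implicit.
Unset Printing Implicit Defensive.

Import Order.TTheory GRing.Theory Num.Theory.
Import numFieldNormedType.Exports.

Local Open Scope classical_set_scope.
Local Open Scope ring_scope.

(** * Affine substitutions and planar rotations *)

Section lebesgue_affine.
Context {R : realType}.
Local Notation leb := (@lebesgue_measure R).

Definition affine (c b : R) (x : measurableTypeR R) : measurableTypeR R := c * x + b.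

Lemma measurable_affine c b : measurable_fun setT (affine c b).
Proof. by apply: measurable_funD => //; apply: measurable_funM. Qed.

Local Notation scaled_pushforward c b := (mscale (NngNum (normr_ge0 c))
  (@measure_function_pushforward__canonical__measure_function_Measure
     _ _ _ _ _ leb (affine c b) (measurable_affine c b))).

Lemma lebesgue_measure_affine (c b : R) : c != 0 ->
  forall A, measurable A -> leb A = scaled_pushforward c b A.
Proof.
move=> c0; apply: lebesgue_measure_unique => _ [[x y]] _ <-.
rewrite [RHS](_ : _ = `|c|%:E * leb (affine c b @^-1` `]x, y]%classic))%E; last by [].

have [cp|cn|] := ltgtP 0 c; last by move/esym/eqP; rewrite (negbTE c0).
- rewrite (_ : affine c b @^-1` _ = `](x - b) / c, (y - b) / c]%classic); last first.
    apply/seteqP; split=> z /=; rewrite !in_itv/= /affine.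
      by rewrite ltr_pdivrMr// ler_pdivlMr// ltrBlDr lerBrDr (mulrC z).
    by rewrite ltr_pdivrMr// ler_pdivlMr// ltrBlDr lerBrDr (mulrC z).
  rewrite !lebesgue_measure_itv/= !lte_fin ltr_pM2r ?invr_gt0// ltrD2r.
  case: ifP => // _; last by rewrite mule0.
  by rewrite -!EFinD -EFinM gtr0_norm//; congr EFin; field.
- rewrite (_ : affine c b @^-1` _ = `[(y - b) / c, (x - b) / c[%classic); last first.
    apply/seteqP; split=> z /=; rewrite !in_itv/= /affine.
      by rewrite ltr_ndivlMr// ler_ndivrMr// ltrBlDr lerBrDr (mulrC z) andbC.
    by rewrite ltr_ndivlMr// ler_ndivrMr// ltrBlDr lerBrDr (mulrC z) andbC.
  rewrite !lebesgue_measure_itv/= !lte_fin ltr_nM2r ?invr_lt0// ltrD2r.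
  case: ifP => // _; last by rewrite mule0.
  by rewrite -!EFinD -EFinM ltr0_norm//; congr EFin; field.
Qed.

Lemma ge0_integral_affine (c b : R) (f : R -> \bar R) : c != 0 ->
  measurable_fun setT f -> (forall x, 0 <= f x)%E ->
  (\int[leb]_x f x = `|c|%:E * \int[leb]_x f (c * x + b)%R)%E.
Proof.
move=> c0 mf f0.
rewrite (eq_measure_integral (scaled_pushforward c b)); last first.
  by move=> A mA _; exact: lebesgue_measure_affine.
rewrite ge0_integral_mscale//=; congr (_ * _)%E.
by rewrite ge0_integral_pushforward//; exact: measurable_affine.
Qed.

(** With the Jacobian inside, the right-hand side needs no further linearity
    step when the integrand is itself a product. *)
Lemma ge0_integral_affine_inner (c b : R) (f : R -> \bar R) : c != 0 ->
  measurable_fun setT f -> (forall x, 0 <= f x)%E ->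
  (\int[leb]_x f x = \int[leb]_x (`|c|%:E * f (c * x + b)%R))%E.
Proof.
move=> c0 mf f0; rewrite (ge0_integral_affine b c0 mf f0) ge0_integralZl//.
exact: measurableT_comp mf (measurable_affine c b).
Qed.

(** [normal_prob] is defined by its density on sets only; uniqueness of the
    Radon-Nikodym derivative extends the formula to integrals. *)
Lemma ge0_integral_normal_prob (f : R -> \bar R) :
  measurable_fun setT f -> (forall x, 0 <= f x)%E ->
  (\int[normal_prob 0 1]_x f x = \int[leb]_x (f x * (normal_pdf 0 1 x)%:E))%E.
Proof.
move=> mf f0; have dom := @normal_prob_dominates R 0 1.
rewrite -(Radon_Nikodym_SigmaFinite.change_of_variables dom)//=.
apply: ae_eq_integral => //.
- apply: emeasurable_funM => //.
  exact: (measurable_int _ (Radon_Nikodym_SigmaFinite.f_integrable dom)).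
- apply: emeasurable_funM => //; apply/measurable_EFinP; exact: measurable_normal_pdf.
- apply: ae_eqe_mul2l; apply: integral_ae_eq => //.
  + exact: Radon_Nikodym_SigmaFinite.f_integrable.
  + by apply/measurable_EFinP; exact: measurable_normal_pdf.
  + by move=> E _ mE; rewrite -Radon_Nikodym_SigmaFinite.f_integral.
Qed.

End lebesgue_affine.

Section gauss2.
Context {R : realType}.
Local Notation leb := (@lebesgue_measure R).
Local Notation RM := (measurableTypeR R).
Local Notation N := (normal_prob (0:R) 1).

Let measurable_lin2 (a b a' b' : R) : measurable_fun setT
  (fun z : RM * RM => (a * z.1 + b * z.2, a' * z.1 + b' * z.2) : RM * RM).
Proof.
by apply/measurable_fun_pair => /=; apply: measurable_funD => //; apply: measurable_funM.
Qed.

(** The rotation is done one variable at a time: [x] is replaced by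
    [c x - s y] for fixed [y], then [y] for fixed [x]; the Jacobians [c] and
    [1 / c] cancel. *)
Lemma lebesgue2_rotation (c s : R) (F : RM * RM -> \bar R) : c ^+ 2 + s ^+ 2 = 1 ->
  c != 0 -> measurable_fun setT F -> (forall z, 0 <= F z)%E ->
  (\int[leb]_x \int[leb]_y F (c * x - s * y, s * x + c * y)%R =
   \int[leb]_x \int[leb]_y F (x, y))%E.
Proof.
move=> cs c0 mF F0.
have mF1 := measurableT_comp mF (measurable_lin2 1 0 (s / c) c^-1).
have mF2 := measurableT_comp mF (measurable_lin2 c (- s) s c).
have nc0 : `|c| != 0 by rewrite normr_eq0.
transitivity (\int[leb]_y \int[leb]_x F (c * x - s * y, s * x + c * y)%R)%E.
  have /= := @fubini_tonelli _ _ _ _ _ leb leb _ mF2 (fun=> F0 _).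
  rewrite /fubini_F /fubini_G /=.
  under eq_integral do under eq_integral do rewrite mulNr.
  by move=> ->; under eq_integral do under eq_integral do rewrite mulNr.
transitivity (\int[leb]_y (`|c|^-1%:E * \int[leb]_x F (x, s / c * x + c^-1 * y)%R))%E.
  apply: eq_integral => y _.
  rewrite (@ge0_integral_affine _ c (- s * y) (fun x => F (x, _)))//; last first.
    have := measurableT_comp mF1 (measurable_pair2 (T1 := RM) (T2 := RM) y).
    by apply: eq_measurable_fun => x _ /=; rewrite mul1r mul0r addr0.
  rewrite muleA -EFinM mulVf// mul1e; apply: eq_integral => x _.
  congr (F (_, _)); rewrite ?mulNr//.
  transitivity (s / c * (c * x - s * y) + (c ^+ 2 + s ^+ 2) / c * y).
    by field.
  by rewrite cs mul1r.
transitivity (\int[leb]_y \int[leb]_x (`|c|^-1%:E * F (x, s / c * x + c^-1 * y)%R))%E.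
  apply: eq_integral => y _; rewrite ge0_integralZl//.
  have := measurableT_comp mF1 (measurable_pair2 (T1 := RM) (T2 := RM) y).
  by apply: eq_measurable_fun => x _ /=; rewrite mul1r mul0r addr0.
transitivity (\int[leb]_x \int[leb]_y (`|c|^-1%:E * F (x, s / c * x + c^-1 * y)%R))%E.
  have mF3 : measurable_fun setT
      (fun z : RM * RM => `|c|^-1%:E * F (z.1, s / c * z.1 + c^-1 * z.2)%R)%E.
    apply: emeasurable_funM => //.
    by apply: eq_measurable_fun mF1 => x _ /=; rewrite mul1r mul0r addr0.
  apply/esym/(@fubini_tonelli _ _ _ _ _ leb leb _ mF3) => z.
  by rewrite mule_ge0// lee_fin invr_ge0.
apply: eq_integral => x _.
have mFx : measurable_fun setT (fun y : RM => F (x, y)).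
  exact: measurableT_comp mF (measurable_pair1 x).
rewrite ge0_integralZl//; last first.
  apply: measurableT_comp mFx _.
  by apply: measurable_funD => //; apply: measurable_funM.
rewrite [RHS](@ge0_integral_affine _ c^-1 (s / c * x))// ?invr_eq0//.
rewrite normfV; congr (_ * _)%E.
by apply: eq_integral => y _; rewrite addrC.
Qed.

Lemma normal_pdf01E (x : R) : normal_pdf 0 1 x = normal_peak 1 * expR (- x ^+ 2 / 2).
Proof.
by rewrite normal_pdfE ?oner_eq0// /normal_fun subr0 expr1n mulr2n.
Qed.

Lemma ge0_integral_normal2 (f : RM * RM -> \bar R) :
  measurable_fun setT f -> (forall z, 0 <= f z)%E ->
  (\int[N]_x \int[N]_y f (x, y) =
   \int[leb]_x \int[leb]_y (f (x, y) * (normal_pdf 0 1 x * normal_pdf 0 1 y)%:E))%E.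
Proof.
move=> mf f0.
have pdf0 := @normal_pdf_ge0 R 0 1.
have mpdf := @measurable_normal_pdf R 0 1.
rewrite ge0_integral_normal_prob; last 2 first.
- exact: (@measurable_fun_fubini_tonelli_F _ _ _ _ _ N).
- by move=> x; apply: integral_ge0.
apply: eq_integral => x _.
have mfx : measurable_fun setT (fun y : RM => f (x, y)).
  exact: measurableT_comp mf (measurable_pair1 x).
rewrite ge0_integral_normal_prob// -ge0_integralZr//=.
- by apply: eq_integral => y _; rewrite -muleA -EFinM (mulrC (normal_pdf 0 1 y)).
- by apply: emeasurable_funM => //; apply/measurable_EFinP.
- by move=> y _; rewrite mule_ge0// lee_fin.
- by rewrite lee_fin.
Qed.

Let sumsq_rot (c s x y : R) : c ^+ 2 + s ^+ 2 = 1 ->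
  - x ^+ 2 / 2 + - y ^+ 2 / 2 =
  - (c * x - s * y) ^+ 2 / 2 + - (s * x + c * y) ^+ 2 / 2.
Proof.
move=> cs; transitivity (- ((c ^+ 2 + s ^+ 2) * (x ^+ 2 + y ^+ 2)) / 2).
  by rewrite cs; field.
by field.
Qed.

Let gauss2_rotation_neq0 (c s : R) (f : RM * RM -> \bar R) : c ^+ 2 + s ^+ 2 = 1 -> c != 0 ->
  measurable_fun setT f -> (forall z, 0 <= f z)%E ->
  (\int[N]_x \int[N]_y f (c * x - s * y, s * x + c * y)%R =
   \int[N]_x \int[N]_y f (x, y))%E.
Proof.
move=> cs c0 mf f0.
have mf2 : measurable_fun setT (fun z : RM * RM => f (c * z.1 - s * z.2, s * z.1 + c * z.2)%R).
  by have := measurableT_comp mf (measurable_lin2 c (- s) s c); under eq_fun do rewrite mulNr.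
apply: (etrans (ge0_integral_normal2 mf2 (fun=> f0 _))).
apply: (etrans _ (esym (ge0_integral_normal2 mf f0))).
pose F (z : RM * RM) := (f z * (normal_pdf 0 1 z.1 * normal_pdf 0 1 z.2)%:E)%E.
apply: etrans _ (@lebesgue2_rotation c s F cs c0 _ _).
- apply: eq_integral => x _; apply: eq_integral => y _ /=; congr (_ * _%:E)%E.
  rewrite /F/= !normal_pdf01E mulrACA [RHS]mulrACA -!expRD; congr (_ * expR _).
  exact: sumsq_rot.
- apply: emeasurable_funM => //; apply/measurable_EFinP; apply: measurable_funM.
    exact: measurableT_comp (measurable_normal_pdf _ _) measurable_fst.
  exact: measurableT_comp (measurable_normal_pdf _ _) measurable_snd.
- by move=> z; rewrite mule_ge0// lee_fin mulr_ge0// normal_pdf_ge0.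
Qed.

(* A rotation by a right angle, which is excluded above as its cosine is zero,
   is the square of a rotation by half a right angle. *)
Let rot45_sqr (a s x y : R) : a ^+ 2 = 2^-1 -> s ^+ 2 = 1 ->
  0 * x - s * y = a * (a * x - s * a * y) - s * a * (s * a * x + a * y) /\
  s * x + 0 * y = s * a * (a * x - s * a * y) + a * (s * a * x + a * y).
Proof.
move=> a2 s2; split.
  transitivity (a ^+ 2 * ((1 - s ^+ 2) * x - 2 * s * y)); last by ring.
  by rewrite a2 s2; field.
transitivity (a ^+ 2 * ((1 - s ^+ 2) * y + 2 * s * x)); last by ring.
by rewrite a2 s2; field.
Qed.

Lemma gauss2_rotation (c s : R) (f : RM * RM -> \bar R) : c ^+ 2 + s ^+ 2 = 1 ->
  measurable_fun setT f -> (forall z, 0 <= f z)%E ->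
  (\int[N]_x \int[N]_y f (c * x - s * y, s * x + c * y)%R =
   \int[N]_x \int[N]_y f (x, y))%E.
Proof.
move=> cs mf f0; have [c0|c0] := eqVneq c 0; last first.
  exact: (gauss2_rotation_neq0 cs c0 mf f0).
have s2 : s ^+ 2 = 1 by move: cs; rewrite c0 expr0n add0r.
pose a : R := (Num.sqrt 2)^-1.
have a2 : a ^+ 2 = 2^-1 by rewrite exprVn sqr_sqrtr.
have a0 : a != 0 by rewrite invr_eq0 sqrtr_eq0 -ltNge.
have as1 : a ^+ 2 + (s * a) ^+ 2 = 1 by rewrite exprMn s2 a2; lra.
apply: etrans _ (gauss2_rotation_neq0 as1 a0 mf f0).
pose g (z : RM * RM) := f (a * z.1 - s * a * z.2, s * a * z.1 + a * z.2)%R.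
apply: etrans _ (@gauss2_rotation_neq0 a (s * a) g as1 a0 _ (fun=> f0 _)).
  apply: eq_integral => x _; apply: eq_integral => y _; rewrite /g/= c0.
  by have [-> ->] := rot45_sqr x y a2 s2.
have := measurableT_comp mf (measurable_lin2 a (- (s * a)) (s * a) a).
by under eq_fun do rewrite mulNr.
Qed.

(** On the line the only rotations are the multiplications by [1] and [-1]. *)
Lemma gauss1_opp (s : R) (f : RM -> \bar R) : s ^+ 2 = 1 ->
  measurable_fun setT f -> (forall z, 0 <= f z)%E ->
  (\int[N]_x f (s * x)%R = \int[N]_x f x)%E.
Proof.
move=> s2 mf f0.
have s0 : s != 0 by apply: contra_eq_neq s2 => ->; rewrite expr0n eq_sym oner_eq0.
have mpdf := @measurable_normal_pdf R 0 1.
have mfs : measurable_fun setT (fun x : RM => f (s * x)%R).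
  by apply: measurableT_comp mf _; apply: measurable_funM.
rewrite !ge0_integral_normal_prob// [RHS](@ge0_integral_affine _ s 0)//.
- have -> : `|s| = 1 by apply/eqP; rewrite -sqrp_eq1// -normrX s2 normr1.
  rewrite mul1e; apply: eq_integral => x _; rewrite addr0; congr (_ * _%:E)%E.
  by rewrite !normal_pdf01E exprMn s2 mul1r.
- by apply: emeasurable_funM => //; apply/measurable_EFinP.
- by move=> x; rewrite mule_ge0// lee_fin normal_pdf_ge0.
Qed.

End gauss2.

(** * Integration by parts on the line *)

Section ftc.
Context {R : realType}.
Local Notation leb := (@lebesgue_measure R).

Lemma integral_is_derive (f F : R -> R) (a b : R) : a <= b ->
  continuous f -> (forall x, is_derive x (1:R) F (f x)) ->
  (\int[leb]_(x in `[a, b]) (f x)%:E = (F b - F a)%:E)%E.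
Proof.
rewrite le_eqVlt => /predU1P[->|ab] cf dF.
  by rewrite set_itv1 integral_set1 subrr.
have cF : continuous F.
  move=> x; apply: differentiable_continuous; apply/derivable1_diffP; exact: ex_derive.
rewrite (@continuous_FTC2 _ f F)//.
- exact: continuous_subspaceT.
- split.
  + by move=> x _; exact: ex_derive.
  + by apply: cvg_at_right_filter; exact: cF.
  + by apply: cvg_at_left_filter; exact: cF.
- by move=> x _; rewrite derive1E derive_val.
Qed.

End ftc.

Lemma measurable_fun_boolr d (T : measurableType d) (R : realType) (b : T -> bool) :
  measurable_fun setT b -> measurable_fun setT (fun x => (b x)%:R : R).
Proof.
move=> mb; rewrite (_ : (fun _ => _) = fun x => if b x then 1 else 0).
  exact: measurable_fun_ifT.
by apply/funext => x; case: (b x).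
Qed.

Section chi2_2.
Context {R : realType}.
Local Notation leb := (@lebesgue_measure R).
Local Notation RM := (measurableTypeR R).
Local Notation N := (normal_prob (0:R) 1).

(** The distribution function of the chi-square law with two degrees of
    freedom, see [normal2_disk]. *)
Definition chi2_2_cdf (s : R) : R := Num.max 0 (1 - expR (- s / 2)).

Lemma measurable_chi2_2_cdf : measurable_fun setT chi2_2_cdf.
Proof.
apply: measurable_maxr => //; apply: measurable_funB => //.
apply: measurableT_comp => //; apply: measurable_funM => //.
Qed.

Lemma chi2_2_cdf_ge0E s : 0 <= s -> chi2_2_cdf s = 1 - expR (- s / 2).
Proof.
by move=> s0; apply/max_r; rewrite subr_ge0 -expR0 ler_expR mulNr oppr_le0 divr_ge0.
Qed.

Lemma chi2_2_cdf_lt0 s : s < 0 -> chi2_2_cdf s = 0.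
Proof.
by move=> s0; apply/max_l; rewrite subr_le0 -expR0 ler_expR mulNr oppr_ge0 mulr_le0_ge0// ltW.
Qed.

Lemma chi2_2_cdf_ge0 s : 0 <= chi2_2_cdf s.
Proof. by rewrite le_max lexx. Qed.

Lemma chi2_2_cdf_le1 s : chi2_2_cdf s <= 1.
Proof. by rewrite ge_max ler01 lerBlDr lerDl expR_ge0. Qed.

(** Positive and negative parts extend the density formula to integrands of
    any sign. *)
Lemma integral_normal_prob (f : R -> \bar R) : measurable_fun setT f ->
  (\int[N]_x f x = \int[leb]_x (f x * (normal_pdf 0 1 x)%:E))%E.
Proof.
move=> mf; have pdf0 x := @normal_pdf_ge0 R 0 1 x.
rewrite integralE [RHS]integralE; congr (_ - _)%E.
  rewrite ge0_integral_normal_prob//; last exact: measurable_funepos.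
  apply: eq_integral => x _.
  by rewrite !funeposE maxe_pMl ?mul0e ?lee_fin.
rewrite ge0_integral_normal_prob//; last exact: measurable_funeneg.
apply: eq_integral => x _.
by rewrite !funenegE maxe_pMl ?mul0e ?mulNe ?lee_fin.
Qed.

(* With [X = t + x] and [psi X = al + be * X], the last factor makes the
   primitive vanish at the two points where [X ^+ 2 = c]. *)
Let stein_primitive (al be t c x : R) : R :=
  (al + be * (t + x)) * (expR (- x ^+ 2 / 2) * (1 - expR (((t + x) ^+ 2 - c) / 2))).

Let stein_derivative (al be t c x : R) : R :=
  expR (- x ^+ 2 / 2) *
   ((be + t * (al + be * (t + x))) * (1 - expR (((t + x) ^+ 2 - c) / 2))
    - (t + x) * (al + be * (t + x))).

Let is_derive_stein (al be t c x : R) :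
  is_derive x (1:R) (stein_primitive al be t c) (stein_derivative al be t c x).
Proof.
rewrite /stein_primitive /stein_derivative; apply: is_derive_eq.
rewrite /GRing.scale/=.
set e1 := expR _; set e2 := expR _.
by field.
Qed.

Let continuous_stein_derivative (al be t c : R) : continuous (stein_derivative al be t c).
Proof.
move=> x; apply/differentiable_continuous/derivable1_diffP.
rewrite /stein_derivative; exact: ex_derive.
Qed.

Let stein_derivativeE (al be t c x k : R) :
  (1 * ((t + x) * (al + be * (t + x))) -
   (1 - expR (((t + x) ^+ 2 - c) / 2)) * (be + t * (al + be * (t + x)))) *
  (k * expR (- x ^+ 2 / 2)) = - k * stein_derivative al be t c x.
Proof. by rewrite /stein_derivative; ring. Qed.

(** Integration by parts against the normal density, on the interval where
    [(t + z) ^+ 2 <= c].  The boundary terms cancel because the factor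
    [chi2_2_cdf (c - (t + z) ^+ 2)] vanishes continuously at the ends. *)
Lemma normal_stein_chi2 (al be t c : R) :
  (\int[N]_z (((t + z) ^+ 2 <= c)%R%:R * ((t + z) * (al + be * (t + z)))
     - chi2_2_cdf (c - (t + z) ^+ 2) * (be + t * (al + be * (t + z))))%:E = 0)%E.
Proof.
pose h (z : R) := ((t + z) ^+ 2 <= c)%R%:R * ((t + z) * (al + be * (t + z)))
  - chi2_2_cdf (c - (t + z) ^+ 2) * (be + t * (al + be * (t + z))).
rewrite (_ : (\int[N]_z _ = \int[N]_z (h z)%:E)%E)//.
have mX : measurable_fun setT (fun z : R => t + z) by exact: measurable_funD.
have mX2 : measurable_fun setT (fun z : R => (t + z) ^+ 2) by exact: measurable_funX.
have maff (u v : R) : measurable_fun setT (fun z : R => u + v * (t + z)).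
  by apply: measurable_funD => //; apply: measurable_funM.
have mh : measurable_fun setT h.
  apply: measurable_funB.
    apply: measurable_funM; last by apply: measurable_funM.
    by apply: measurable_fun_boolr; exact: measurable_fun_ler.
  apply: measurable_funM.
    apply: measurableT_comp; first exact: measurable_chi2_2_cdf.
    exact: measurable_funB.
  by apply: measurable_funD => //; apply: measurable_funM.
have [c0|c0] := ltP c 0.
  rewrite (_ : h = cst 0) ?integral0//; apply/funext => z; rewrite /h/=.
  have /negbTE -> : ~~ ((t + z) ^+ 2 <= c) by rewrite -ltNge (lt_le_trans c0)// sqr_ge0.
  by rewrite chi2_2_cdf_lt0 ?mul0r ?subr0// subr_lt0 (lt_le_trans c0)// sqr_ge0.
rewrite integral_normal_prob; last exact/measurable_EFinP.
pose k := - normal_peak (1 : R).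
transitivity (\int[leb]_(x in `[(- Num.sqrt c - t)%R, (Num.sqrt c - t)%R])
    (k * stein_derivative al be t c x)%:E)%E.
  rewrite [RHS]integral_mkcond; apply: eq_integral => x _.
  have xc : (x \in `[- Num.sqrt c - t, Num.sqrt c - t]%classic) = ((t + x) ^+ 2 <= c).
    by rewrite mem_setE in_itv/= lerBlDr lerBrDr (addrC x) -ler_norml -sqrtr_sqr ler_sqrt.
  rewrite patchE xc /h normal_pdf01E -EFinM /k.
  case: ifPn => [xc'|]; last first.
    by rewrite -ltNge => xc'; rewrite chi2_2_cdf_lt0 ?subr_lt0// !mul0r subrr mul0r.
  rewrite chi2_2_cdf_ge0E ?subr_ge0// opprB ; congr EFin; exact: stein_derivativeE.
have dF (x : R) : is_derive x (1:R) (fun x => k * stein_primitive al be t c x)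
    (k * stein_derivative al be t c x).
  exact: (is_deriveZ k (is_derive_stein al be t c x)).
have cf : continuous (fun x : R => k * stein_derivative al be t c x).
  by move=> x; apply: cvgM; [exact: cvg_cst|exact: continuous_stein_derivative].
have ab : - Num.sqrt c - t <= Num.sqrt c - t.
  by rewrite lerD2r lerNl (le_trans _ (sqrtr_ge0 _))// oppr_le0 sqrtr_ge0.
rewrite (integral_is_derive ab cf dF) /stein_primitive !(addrC t) !subrK sqrrN.
by rewrite sqr_sqrtr// subrr mul0r expR0 subrr !mulr0 subrr.
Qed.

End chi2_2.

(** * The planar Gaussian measure of a disk *)

Section disk.
Context {R : realType}.
Local Notation leb := (@lebesgue_measure R).
Local Notation RM := (measurableTypeR R).
Local Notation N := (normal_prob (0:R) 1).

(* The planar standard normal density at squared radius [w], cut at [w <= s]. *)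
Let G (s w : R) : R := (w <= s)%R%:R * (normal_peak 1 ^+ 2 * expR (- w / 2)).

Let G_ge0 s w : 0 <= G s w.
Proof. by rewrite mulr_ge0// mulr_ge0// sqr_ge0. Qed.

Let measurable_G s : measurable_fun setT (G s).
Proof.
apply: measurable_funM.
  by apply: measurable_fun_boolr; exact: measurable_fun_ler.
apply: measurable_funM => //; apply: measurableT_comp => //.
exact: measurable_funM.
Qed.

Let is_derive_gauss (x : R) :
  is_derive x (1:R) (fun x : R => expR (- x ^+ 2 / 2)) (- x * expR (- x ^+ 2 / 2)).
Proof. by apply: is_derive_eq; rewrite /GRing.scale/=; field. Qed.

Let continuous_xgauss : continuous (fun x : R => - x * expR (- x ^+ 2 / 2)).
Proof.
by move=> x; apply/differentiable_continuous/derivable1_diffP; exact: ex_derive.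
Qed.

Let integral_radial s : 0 <= s ->
  (\int[leb]_v (`|v| * G s (v ^+ 2))%:E =
   (normal_peak 1 ^+ 2 * (2 * (1 - expR (- s / 2))))%:E)%E.
Proof.
move=> s0; pose a := Num.sqrt s; have a0 : 0 <= a by exact: sqrtr_ge0.
have a2 : a ^+ 2 = s by exact: sqr_sqrtr.
pose k := normal_peak (1 : R) ^+ 2; have k0 : 0 <= k by exact: sqr_ge0.
have mf : measurable_fun setT (fun x : R => `|x| * (k * expR (- x ^+ 2 / 2))).
  apply: measurable_funM => //; apply: measurable_funM => //.
  apply: measurableT_comp => //; apply: measurable_funM => //.
  by apply: measurable_funN; exact: measurable_funX.
transitivity (\int[leb]_(x in `[(- a)%R, a]) (`|x| * (k * expR (- x ^+ 2 / 2)))%:E)%E.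
  rewrite [RHS]integral_mkcond; apply: eq_integral => x _.
  have xa : (x \in `[(- a)%R, a]%classic) = (x ^+ 2 <= s).
    by rewrite mem_setE in_itv/= -ler_norml -sqrtr_sqr ler_sqrt.
  rewrite patchE xa /G; case: ifP => _; first by rewrite mul1r.
  by rewrite !mul0r mulr0.
rewrite (_ : `[(- a)%R, a]%classic = `[(- a)%R, 0%R[%classic `|` `[0%R, a]%classic); last first.
  apply/seteqP; split => x/=; rewrite !in_itv/=.
    by move=> /andP[-> ->]; rewrite andbT/=; case: ltP; [left|right].
  move=> [/andP[-> x0]|/andP[x0 ->]]/=; first by rewrite (le_trans (ltW x0)).
  by rewrite andbT (le_trans _ x0)// oppr_le0.
rewrite ge0_integral_setU//=; last 3 first.
- by apply/measurable_EFinP; exact: measurable_funTS.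
- by move=> x _; rewrite lee_fin mulr_ge0// mulr_ge0.
- apply/disj_setPS => x/= []; rewrite !in_itv/= => /andP[_ x0] /andP[x1 _].
  by move: x0; rewrite ltNge x1.
rewrite integral_itv_bndo_bndc; last first.
  by apply/measurable_EFinP; exact: measurable_funTS.
have cf (u : R) : continuous (fun x : R => u * (- x * expR (- x ^+ 2 / 2))).
  by move=> x; apply: cvgM; [exact: cvg_cst|exact: continuous_xgauss].
have dF (u : R) (x : R) : is_derive x (1:R) (fun x => u * expR (- x ^+ 2 / 2))
    (u * (- x * expR (- x ^+ 2 / 2))).
  exact: (is_deriveZ u (is_derive_gauss x)).
have Na0 : - a <= 0 by rewrite oppr_le0.
have e0 : - 0 ^+ 2 / 2 = 0 :> R by rewrite expr0n oppr0 mul0r.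
rewrite [X in (X + _)%E](_ : _ = (k * (1 - expR (- s / 2)))%:E); last first.
  have /= := integral_is_derive Na0 (cf k) (dF k).
  rewrite sqrrN a2 e0 expR0 mulrBr => <-.
  apply: eq_integral => x; rewrite inE/= in_itv/= => /andP[_ x0].
  by rewrite ler0_norm// mulrCA.
rewrite [X in (_ + X)%E](_ : _ = (k * (1 - expR (- s / 2)))%:E); last first.
  have /= := integral_is_derive a0 (cf (- k)) (dF (- k)).
  rewrite a2 e0 expR0 !mulNr opprK addrC mulrBr => <-.
  apply: eq_integral => x; rewrite inE/= in_itv/= => /andP[x0 _].
  by rewrite ger0_norm// !mulNr mulrN opprK mulrCA.
by rewrite -EFinD; congr EFin; rewrite mulrCA mulr2n mulrDl mul1r.
Qed.

Let integral_oneDsqrV : (\int[leb]_u (oneDsqr u)^-1%:E = pi%:E)%E.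
Proof.
rewrite ge0_symfun_integralT//.
- rewrite (_ : [set x : R | 0 <= x] = `[0, +oo[%classic); last first.
    by apply/seteqP; split => x/=; rewrite in_itv/= andbT.
  by rewrite integral0y_oneDsqr -EFinM; congr EFin; field.
- exact: continuous_oneDsqrV.
- by move=> x /=; rewrite /oneDsqr sqrrN.
Qed.

(** The substitution [y = x u] turns [x^2 + y^2] into [x^2 (1 + u^2)]; rescaling
    [x] by [sqrt (1 + u^2)] then separates the integral into the radial one
    [integral_radial] and the integral of [1 / (1 + u^2)]. *)
Lemma normal2_disk s :
  (\int[N]_x \int[N]_y ((x ^+ 2 + y ^+ 2 <= s)%R%:R)%:E = (chi2_2_cdf s)%:E)%E.
Proof.
have [s0|s0] := ltP s 0.
  rewrite chi2_2_cdf_lt0// integral0_eq// => x _; rewrite integral0_eq// => y _.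
  by rewrite leNgt (lt_le_trans s0)// addr_ge0// sqr_ge0.
have mS : measurable_fun setT (fun z : RM * RM => z.1 ^+ 2 + z.2 ^+ 2).
  by apply: measurable_funD; apply: measurable_funX.
have mG : measurable_fun setT (fun z : RM * RM => (G s (z.1 ^+ 2 + z.2 ^+ 2))%:E).
  by apply/measurable_EFinP; exact: measurableT_comp (measurable_G s) mS.
pose H (z : RM * RM) : \bar R := (`|z.1| * G s (z.1 ^+ 2 * oneDsqr z.2))%:E.
have mH : measurable_fun setT H.
  apply/measurable_EFinP; apply: measurable_funM; first exact: measurableT_comp.
  apply: (measurableT_comp (measurable_G s)).
  apply: measurable_funM; first exact: measurable_funX.
  by apply: measurable_funD => //; exact: measurable_funX.
have H0 z : (0 <= H z)%E by rewrite lee_fin mulr_ge0.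
transitivity (\int[leb]_x \int[leb]_y (G s (x ^+ 2 + y ^+ 2))%:E)%E.
  have mb : measurable_fun setT (fun z : RM * RM => ((z.1 ^+ 2 + z.2 ^+ 2 <= s)%R%:R : R)%:E).
    by apply/measurable_EFinP; apply: measurable_fun_boolr; exact: measurable_fun_ler.
  have b0 (z : RM * RM) : (0 <= ((z.1 ^+ 2 + z.2 ^+ 2 <= s)%R%:R : R)%:E)%E.
    by rewrite lee_fin.
  apply: (etrans (ge0_integral_normal2 mb b0)).
  apply: eq_integral => x _; apply: eq_integral => y _.
  rewrite -EFinM !normal_pdf01E mulrACA -expr2 -expRD.
  by congr (_ * (_ * expR _))%:E; rewrite -mulrDl -opprD.
transitivity (\int[leb]_x \int[leb]_u H (x, u))%E.
  apply: ae_eq_integral => //.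
  - apply: (@measurable_fun_fubini_tonelli_F _ _ _ _ _ leb _ mG) => z.
    by rewrite lee_fin.
  - exact: (@measurable_fun_fubini_tonelli_F _ _ _ _ _ leb _ mH H0).
  (* the substitution is singular at x = 0 only *)
  - exists [set 0]; split => //; first exact: lebesgue_measure_set1.
    move=> x /= Hx; apply: contrapT => /eqP x0; apply: Hx => _.
    have mGx := measurableT_comp mG (measurable_pair1 (x : RM)).
    have GX y : (0 <= (G s (x ^+ 2 + y ^+ 2))%:E)%E by rewrite lee_fin.
    apply: (etrans (ge0_integral_affine_inner 0 x0 mGx GX)).
    apply: eq_integral => u _; rewrite -EFinM /H/=; congr (_ * G _ _)%:E.
    by rewrite addr0 exprMn /oneDsqr mulrDr mulr1.
rewrite (@fubini_tonelli _ _ _ _ _ leb leb _ mH H0) /fubini_G.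
transitivity (\int[leb]_u ((oneDsqr u)^-1%:E *
    (normal_peak 1 ^+ 2 * (2 * (1 - expR (- s / 2))))%:E))%E.
  apply: eq_integral => u _.
  have ou : 0 < oneDsqr u by exact: lt_le_trans ltr01 (oneDsqr_ge1 _).
  pose r := (Num.sqrt (oneDsqr u))^-1.
  have r0 : 0 < r by rewrite invr_gt0 sqrtr_gt0.
  have r2 : r ^+ 2 * oneDsqr u = 1 by rewrite exprVn sqr_sqrtr ?ltW// mulVf// gt_eqF.
  have mHu := measurableT_comp mH (measurable_pair2 (u : RM)).
  apply: (etrans (ge0_integral_affine_inner 0 (lt0r_neq0 r0) mHu (fun=> H0 _))).
  rewrite -(integral_radial s0) (_ : (oneDsqr u)^-1 = r ^+ 2); last first.
    by rewrite exprVn sqr_sqrtr// ltW.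
  have mJ : measurable_fun setT (fun v : RM => (`|v| * G s (v ^+ 2))%:E).
    apply/measurable_EFinP; apply: measurable_funM => //.
    by apply: (measurableT_comp (measurable_G s)); exact: measurable_funX.
  have J0 (v : RM) : setT v -> (0 <= (`|v| * G s (v ^+ 2))%:E)%E.
    by rewrite lee_fin mulr_ge0.
  apply: etrans _ (ge0_integralZl_EFin leb measurableT J0 mJ (sqr_ge0 r)).
  apply: eq_integral => v _; rewrite -!EFinM /H/= addr0 normrM (gtr0_norm r0).
  have -> : (r * v) ^+ 2 * oneDsqr u = v ^+ 2 by rewrite exprMn mulrAC r2 mul1r.
  by rewrite -mulrA [r * (r * _)]mulrA.
rewrite ge0_integralZr//=; last 2 first.
- apply/measurable_EFinP; apply: continuous_measurable_fun; exact: continuous_oneDsqrV.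
- rewrite lee_fin -(chi2_2_cdf_ge0E s0); apply: mulr_ge0; first exact: sqr_ge0.
  by rewrite mulr_ge0// chi2_2_cdf_ge0.
rewrite integral_oneDsqrV -EFinM chi2_2_cdf_ge0E//; congr EFin.
rewrite /normal_peak exprVn sqr_sqrtr ?mulrn_wge0 ?mulr_ge0 ?sqr_ge0 ?pi_ge0//.
rewrite expr1n mul1r; move: (@pi R) (pi_gt0 R) => t t0.
by field; rewrite gt_eqF.
Qed.

End disk.

(** * Rotation invariance of the standard normal law *)

Section std_normal.
Context {R : realType}.
Local Notation RM := (measurableTypeR R).
Local Notation N := (normal_prob (0:R) 1).

Lemma measurable_mulmx m n (A : 'M[R]_(m, n)) :
  measurable_fun setT (fun z : 'cV[R]_n => A *m z).
Proof.
apply/measurable_fun_mxP => i j; under eq_fun do rewrite mxE.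
apply: measurable_sum => k; apply: measurable_funM => //.
exact: measurable_mx_coor.
Qed.

Lemma measurable_addmx n (m : 'cV[R]_n) : measurable_fun setT (fun z : 'cV[R]_n => m + z).
Proof.
apply/measurable_fun_mxP => i j; under eq_fun do rewrite mxE.
by apply: measurable_funD => //; exact: measurable_mx_coor.
Qed.

Lemma consvE n (x : RM) (y : 'cV[R]_n) : consv (x, y) = col_mx (x : R)%:M y :> 'cV[R]_(1 + n).
Proof.
apply/matrixP => i j; rewrite [LHS]mxE [j]ord1; case: unliftP => [k|] ->.
  rewrite (_ : lift ord0 k = rshift 1 k); last exact: val_inj.
  by rewrite (@col_mxEd _ 1).
rewrite (_ : ord0 = lshift n (ord0 : 'I_1)); last exact: val_inj.
by rewrite (@col_mxEu _ 1) mxE.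
Qed.

Lemma ge0_integral_std_normalS n (f : 'cV[R]_n.+1 -> \bar R) :
  measurable_fun setT f -> (forall z, 0 <= f z)%E ->
  (\int[std_normal n.+1]_z f z = \int[N]_x \int[std_normal n]_y f (consv (x, y)))%E.
Proof.
move=> mf f0 /=; rewrite ge0_integral_distribution//.
apply: (@fubini_tonelli1 _ _ _ _ _ N (std_normal n) (f \o @consv R n)) => [|z]; last exact: f0.
exact: measurableT_comp mf (@measurable_consv R n).
Qed.

Lemma ge0_integral_std_normalSC n (f : 'cV[R]_n.+1 -> \bar R) :
  measurable_fun setT f -> (forall z, 0 <= f z)%E ->
  (\int[std_normal n.+1]_z f z = \int[std_normal n]_y \int[N]_x f (consv (x, y)))%E.
Proof.
move=> mf f0; rewrite ge0_integral_std_normalS//.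
apply: (@fubini_tonelli _ _ _ _ _ N (std_normal n) (f \o @consv R n)) => [|z]; last exact: f0.
exact: measurableT_comp mf (@measurable_consv R n).
Qed.

Definition std_normal_invariant n (O : 'M[R]_n) := forall f : 'cV[R]_n -> \bar R,
  measurable_fun setT f -> (forall z, 0 <= f z)%E ->
  (\int[std_normal n]_z f (O *m z) = \int[std_normal n]_z f z)%E.

Lemma std_normal_invariantM n (O1 O2 : 'M[R]_n) :
  std_normal_invariant O1 -> std_normal_invariant O2 -> std_normal_invariant (O1 *m O2).
Proof.
move=> i1 i2 f mf f0; rewrite -(i1 f)// -(i2 (fun z => f (O1 *m z)))//.
  by apply: eq_integral => z _; rewrite mulmxA.
exact: measurableT_comp mf (measurable_mulmx O1).
Qed.

Lemma std_normal_invariant1 (s : R) : s ^+ 2 = 1 -> @std_normal_invariant 1 s%:M.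
Proof.
move=> s2 f mf f0; rewrite !ge0_integral_std_normalS//; last first.
  exact: measurableT_comp mf (measurable_mulmx _).
rewrite (_ : (\int[N]_x _)%E =
    (\int[N]_x \int[@std_normal R 0]_y f (consv ((s * x)%R : RM, y)))%E); last first.
  apply: eq_integral => x _; apply: eq_integral => y _; congr f.
  rewrite !consvE mul_scalar_mx (@scale_col_mx _ 1 0) scale_scalar_mx.
  by rewrite (flatmx0 (s *: y)) (flatmx0 y).
apply: (gauss1_opp s2 (f := fun x => \int[@std_normal R 0]_y f (consv (x, y)))%E).
  apply: (@measurable_fun_fubini_tonelli_F _ _ _ _ _
    (@std_normal R 0) (f \o @consv R 0)) => [|z]; last exact: f0.
  exact: measurableT_comp mf (@measurable_consv R 0).
by move=> x; apply: integral_ge0.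
Qed.

Lemma std_normal_invariant_block n (O : 'M[R]_n) : std_normal_invariant O ->
  @std_normal_invariant (1 + n) (block_mx 1%:M 0 0 O).
Proof.
move=> iO f mf f0; rewrite !ge0_integral_std_normalS//; last first.
  exact: measurableT_comp mf (measurable_mulmx _).
apply: eq_integral => x _.
have mfx : measurable_fun setT (fun y : 'cV[R]_n => f (consv (x, y))).
  exact: (measurableT_comp mf (measurableT_comp (@measurable_consv R n) (measurable_pair1 x))).
rewrite -(iO (fun y => f (consv (x, y))))//.
apply: eq_integral => y _; rewrite !consvE (@mul_block_col _ 1 n 1 n).
by rewrite mul1mx !mul0mx addr0 add0r.
Qed.

(** The rotation of the plane of the first two coordinates with cosine [c] and
    sine [s]. *)
Definition rot_mx n (c s : R) : 'M[R]_(1 + (1 + n)) :=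
  block_mx c%:M (row_mx (- s)%:M 0) (col_mx s%:M 0) (block_mx c%:M 0 0 1%:M).

Lemma std_normal_invariant_rot n (c s : R) : c ^+ 2 + s ^+ 2 = 1 ->
  std_normal_invariant (rot_mx n c s).
Proof.
move=> cs f mf f0; rewrite !ge0_integral_std_normalS//; last first.
  exact: measurableT_comp mf (measurable_mulmx _).
have mfx x : measurable_fun setT (fun y : 'cV[R]_n.+1 => f (consv (x, y))).
  exact: (measurableT_comp mf (measurableT_comp (@measurable_consv R n.+1) (measurable_pair1 x))).
transitivity (\int[N]_x \int[N]_x' \int[std_normal n]_y
    f (consv ((c * x - s * x')%R : RM, consv ((s * x + c * x')%R : RM, y))))%E.
  apply: eq_integral => x _; rewrite ge0_integral_std_normalS//; last first.
    exact: measurableT_comp (measurableT_comp mf (measurable_mulmx (rot_mx n c s)))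
     (measurableT_comp (@measurable_consv R n.+1) (measurable_pair1 x)).
  apply: eq_integral => x' _; apply: eq_integral => y _; congr f.
  rewrite !consvE /rot_mx (@mul_block_col _ 1 (1 + n) 1 (1 + n)).
  rewrite (@mul_row_col _ 1 1 n) (@mul_block_col _ 1 n 1 n) (@mul_col_mx _ 1 n).
  rewrite (@add_col_mx _ 1 n) !mul0mx !mul1mx !addr0 !add0r.
  by rewrite !mul_scalar_mx !scale_scalar_mx -!raddfD/= mulNr.
transitivity (\int[N]_x \int[N]_x' \int[std_normal n]_y f (consv (x, consv (x', y))))%E.
  pose g (z : RM * RM) := (\int[std_normal n]_y f (consv (z.1, consv (z.2, y))))%E.
  apply: (gauss2_rotation cs (f := g)); last by move=> z; apply: integral_ge0.
  apply: (@measurable_fun_fubini_tonelli_F _ _ _ _ _ (std_normal n)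
    (fun w => f (consv (w.1.1, consv (w.1.2, w.2))))) => //.
  apply: (measurableT_comp mf); apply: (measurableT_comp (@measurable_consv R n.+1)).
  apply/measurable_fun_pair => /=; first exact: measurableT_comp measurable_fst measurable_fst.
  apply: (measurableT_comp (@measurable_consv R n)).
  apply/measurable_fun_pair => //=; exact: measurableT_comp measurable_snd measurable_fst.
by apply: eq_integral => x _; rewrite ge0_integral_std_normalS.
Qed.

End std_normal.

Section orthonormal.
Context {R : realType}.
Local Notation RM := (measurableTypeR R).
Local Notation N := (normal_prob (0:R) 1).

Lemma rot_mx_orthogonal n (c s : R) : c ^+ 2 + s ^+ 2 = 1 ->
  rot_mx n c s *m (rot_mx n c s)^T = 1%:M.
Proof.
move=> cs; rewrite /rot_mx !(tr_block_mx, tr_col_mx, tr_row_mx, tr_scalar_mx, trmx0, trmx1).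
rewrite !(mulmx_block, mul_mx_row, mul_col_row, mul_row_col, mul_row_block,
  mul_block_col, mul_col_mx, mul_scalar_mx, mulmx0, mul0mx, mulmx1,
  add_row_mx, add_col_mx, addr0, add0r).
rewrite !(scale_scalar_mx, scaler0, scale1r, addr0, add0r) -block_mxEh add_block_mx !(addr0, add0r).
rewrite -!(raddfD (@scalar_mx R 1))/= !mulrN !mulNr opprK (mulrC s c) subrr.
rewrite -!expr2 (addrC (s ^+ 2)) cs.
rewrite raddf0 row_mx0 col_mx0.
by rewrite -(@scalar_mx_block _ 1 n) -scalar_mx_block.
Qed.

Lemma mulmx_tr_row n (w : 'rV[R]_n) : w *m w^T = (\sum_i w 0 i ^+ 2)%:M.
Proof.
apply/matrixP => i j; rewrite !ord1 !mxE eqxx mulr1n.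
by apply: eq_bigr => k _; rewrite mxE expr2.
Qed.

Lemma row_polar n (w : 'rV[R]_n.+1) : exists u : 'rV[R]_n.+1,
  u *m u^T = 1%:M /\ w = Num.sqrt (\sum_i w 0 i ^+ 2) *: u.
Proof.
set q := \sum_i _; have q0 : 0 <= q by apply: sumr_ge0 => i _; exact: sqr_ge0.
have [qE|q_neq0] := eqVneq q 0.
  exists (delta_mx 0 0); split.
    by rewrite trmx_delta mul_delta_mx; apply/matrixP => i j; rewrite !ord1 !mxE.
  rewrite qE sqrtr0 scale0r; apply/rowP => i; rewrite mxE; apply/eqP; rewrite -sqrf_eq0.
  move/eqP: qE; rewrite psumr_eq0 => [/allP/(_ i)|j _]; last exact: sqr_ge0.
  by rewrite mem_index_enum; apply.
exists ((Num.sqrt q)^-1 *: w).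
have sq0 : Num.sqrt q != 0 by rewrite gt_eqF// sqrtr_gt0 lt0r q_neq0.
split; last by rewrite scalerA mulfV// scale1r.
rewrite linearZ/= -scalemxAl -scalemxAr scalerA mulmx_tr_row scale_scalar_mx.
by rewrite -expr2 exprVn sqr_sqrtr// mulVf.
Qed.

Lemma delta_mx00E m : delta_mx 0 0 = row_mx 1%:M 0 :> 'rV[R]_(1 + m).
Proof.
apply/rowP => j; rewrite mxE eqxx [RHS]mxE -val_eqE.
by case: splitP => k jk; rewrite mxE [X in (X == _)%:R]jk ?ord1 ?eqxx.
Qed.

(** By induction a rotation of the last coordinates makes [w] a combination of
    the first two axes; a planar rotation finishes. *)
Lemma std_normal_rotate_to_axis n (w : 'rV[R]_n.+1) : w *m w^T = 1%:M ->
  exists O : 'M[R]_n.+1,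
    [/\ O *m O^T = 1%:M, w *m O = delta_mx 0 0 & std_normal_invariant O].
Proof.
elim: n w => [|n IHn] w w1.
  have s2 : w 0 0 ^+ 2 = 1.
    by move/matrixP/(_ 0 0) : w1; rewrite mulmx_tr_row big_ord1 !mxE eqxx !mulr1n.
  have ss : (w 0 0)%:M *m (w 0 0)%:M = 1%:M :> 'M[R]_1.
    by rewrite mul_scalar_mx scale_scalar_mx -expr2 s2.
  exists (w 0 0)%:M; split.
  - by rewrite tr_scalar_mx.
  - by rewrite [X in X *m _]mx11_scalar ss; apply/matrixP => i j; rewrite !ord1 !mxE.
  - exact: std_normal_invariant1.
pose w' : 'rV[R]_(1 + n.+1) := w.
pose s := lsubmx w' 0 0.
have [u [u1]] := row_polar (rsubmx w'); set rho := Num.sqrt _ => ru.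
have wE : w = row_mx s%:M (rho *: u) :> 'rV[R]_(1 + n.+1).
  by rewrite -ru /s -mx11_scalar hsubmxK.
have sr : s ^+ 2 + rho ^+ 2 = 1.
  have := w1; rewrite wE (@tr_row_mx _ 1 1 n.+1) (@mul_row_col _ 1 1 n.+1) tr_scalar_mx.
  rewrite linearZ/= -scalemxAl -scalemxAr u1 mul_scalar_mx scalerA !scale_scalar_mx mulr1.
  by rewrite -!expr2 -raddfD => /matrixP/(_ 0 0); rewrite !mxE eqxx !mulr1n.
have [ O [OO uO iO]] := IHn u u1.
exists (block_mx 1%:M 0 0 O *m rot_mx n s rho : 'M[R]_(1 + n.+1)); split.
- rewrite trmx_mul mulmxA -[X in X *m _]mulmxA rot_mx_orthogonal// mulmx1.
  rewrite (@tr_block_mx _ 1 n.+1 1 n.+1) (@mulmx_block _ 1 n.+1 1 n.+1 1 n.+1).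
  by rewrite !trmx0 !mulmx0 !mul0mx trmx1 mulmx1 OO !addr0 add0r -scalar_mx_block.
- rewrite mulmxA wE (@mul_row_block _ 1 1 n.+1 1 n.+1) !mulmx0 mulmx1 addr0 add0r.
  rewrite -scalemxAl uO.
  rewrite (delta_mx00E n) (delta_mx00E n.+1) /rot_mx (@scale_row_mx _ 1 1 n) scaler0.
  rewrite (@mul_row_block _ 1 1 n.+1 1 n.+1) (@mul_row_col _ 1 1 n) (@mul_row_block _ 1 1 n 1 n).
  rewrite (@mul_mx_row _ 1 1 1 n) (@add_row_mx _ 1 1 n).
  rewrite !(mulmx0, mul0mx, addr0, mul_scalar_mx, scale_scalar_mx, mulr1, mul1r).
  rewrite -!(raddfD (@scalar_mx R 1))/= -!expr2 sr mulrN mulrC addNr raddf0.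
  by rewrite scaler0 addr0 (@row_mx0 _ 1 1 n).
- apply: std_normal_invariantM; first exact: std_normal_invariant_block.
  exact: std_normal_invariant_rot.
Qed.

(** Induction on the number of rows: once a rotation has carried the first row
    of [B] to the first axis, orthogonality makes the first entry of the other
    rows zero, so that the first coordinate splits off on both sides. *)
Lemma std_normal_orthonormal_rows l k (B : 'M[R]_(l, k)) : B *m B^T = 1%:M ->
  forall f : 'cV[R]_l -> \bar R, measurable_fun setT f -> (forall z, 0 <= f z)%E ->
  (\int[std_normal k]_z f (B *m z) = \int[std_normal l]_z f z)%E.
Proof.
elim: l k B => [|l IHl] k B BB f mf f0.
  rewrite (_ : (fun z => f _) = cst (f 0)); last by apply/funext => z; rewrite [_ *m _]flatmx0.
  rewrite [in RHS](_ : f = cst (f 0)); last by apply/funext => z; rewrite [z]flatmx0.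
  by rewrite !integral_cst//= !probability_setT.
case: k B BB => [|k] B BB.
  move: BB; rewrite [B]thinmx0 mul0mx => /matrixP/(_ 0 0)/eqP.
  by rewrite !mxE eqxx eq_sym oner_eq0.
pose B' : 'M[R]_(1 + l, k.+1) := B.
have BE : B = col_mx (usubmx B') (dsubmx B') :> 'M[R]_(1 + l, k.+1) by rewrite vsubmxK.
have := BB; rewrite BE (@tr_col_mx _ 1 l) (@mul_col_row _ 1 l _ 1 l) [RHS](@scalar_mx_block _ 1 l).
move=> /(@eq_block_mx _ 1 l 1 l)[w1 wC _ CC].
have [ O [OO wO iO]] := std_normal_rotate_to_axis w1.
set w := usubmx B' in w1 wC wO *; set C := dsubmx B' in wC CC *.
pose C1 : 'M[R]_(l, k) := rsubmx (C *m O : 'M[R]_(l, 1 + k)).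
have CO : C *m O = row_mx 0 C1 :> 'M[R]_(l, 1 + k).
  rewrite -[LHS](@hsubmxK _ l 1 k); congr (row_mx _ _).
  have : w *m O *m (C *m O)^T = 0.
    by rewrite trmx_mul mulmxA -(mulmxA w) OO mulmx1 wC.
  rewrite wO delta_mx00E -[C *m O](@hsubmxK _ l 1 k) (@tr_row_mx _ l 1 k).
  rewrite (@mul_row_col _ 1 1 k) mul1mx mul0mx addr0 => /(congr1 trmx).
  by rewrite trmxK trmx0 row_mxKl.
have C1C1 : C1 *m C1^T = 1%:M.
  have : C *m O *m (C *m O)^T = 1%:M by rewrite trmx_mul mulmxA -(mulmxA C) OO mulmx1 CC.
  by rewrite CO (@tr_row_mx _ l 1 k) (@mul_row_col _ l 1 k) mul0mx add0r.
have mfB := measurableT_comp mf (measurable_mulmx (col_mx w C : 'M[R]_(l.+1, k.+1))).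
rewrite -(iO _ mfB (fun=> f0 _)) !ge0_integral_std_normalS//; last first.
- by move=> z; exact: f0.
- exact: measurableT_comp mfB (measurable_mulmx O).
apply: eq_integral => x _.
have mfx : measurable_fun setT (fun y : 'cV[R]_l => f (consv (x, y))).
  exact: (measurableT_comp mf (measurableT_comp (@measurable_consv R l) (measurable_pair1 x))).
rewrite -(IHl _ _ C1C1 _ mfx)//.
apply: eq_integral => y _; congr f; rewrite mulmxA (@mul_col_mx _ 1 l) wO CO !consvE delta_mx00E.
rewrite (@mul_col_mx _ 1 l) !(@mul_row_col _ _ 1 k).
by rewrite mul1mx !mul0mx addr0 add0r.
Qed.

End orthonormal.

(** * Integration by parts in higher dimension *)

Section laws.
Context {R : realType}.
Context d1 d2 d (X1 : measurableType d1) (X2 : measurableType d2) (Z : measurableType d).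
Variables (mu1 : {measure set X1 -> \bar R}) (mu2 : {measure set X2 -> \bar R}).
Variables (phi1 : X1 -> Z) (phi2 : X2 -> Z).

Definition same_law := forall f : Z -> \bar R,
  measurable_fun setT f -> (forall z, 0 <= f z)%E ->
  (\int[mu1]_x f (phi1 x) = \int[mu2]_x f (phi2 x))%E.

(** Positive and negative parts carry the transfer from nonnegative integrands
    to all measurable ones. *)
Lemma same_law_integral (f : Z -> \bar R) : same_law -> measurable_fun setT f ->
  (\int[mu1]_x f (phi1 x) = \int[mu2]_x f (phi2 x))%E.
Proof.
move=> law mf; rewrite integralE [RHS]integralE; congr (_ - _)%E.
  apply: etrans (etrans _ (law _ (measurable_funepos mf) (funepos_ge0 f))) _;
    by apply: eq_integral => x _; rewrite !funeposE.
apply: etrans (etrans _ (law _ (measurable_funeneg mf) (funeneg_ge0 f))) _;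
  by apply: eq_integral => x _; rewrite !funenegE.
Qed.

End laws.

Lemma bounded_integrable d (T : measurableType d) (R : realType) (P : probability T R)
    (M : R) (f : T -> R) : measurable_fun setT f -> (forall x, `|f x| <= M) ->
  P.-integrable setT (EFin \o f).
Proof.
move=> mf fM; apply: measurable_bounded_integrable => //.
  exact: le_lt_trans (probability_le1 P measurableT) (ltry 1).
exists M; split; first exact: num_real.
by move=> N MN x _; exact: le_trans (fM x) (ltW MN).
Qed.

Section vectors.
Context {R : realType}.
Local Notation RM := (measurableTypeR R).

Definition dotv n (a x : 'cV[R]_n) : R := (a^T *m x) 0 0.

Definition inball n (c : R) (x : 'cV[R]_n) : R := (sqnorm x <= c)%R%:R.

(** Two centred coordinates are added; norms and inner products are kept. *)
Definition pad2 n (x : 'cV[R]_n) : 'cV[R]_n.+2 := consv (0 : RM, consv (0 : RM, x)).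

Lemma dotvE n (a x : 'cV[R]_n) : dotv a x = \sum_i a i 0 * x i 0.
Proof. by rewrite /dotv mxE; apply: eq_bigr => i _; rewrite mxE. Qed.

Lemma sqnorm_dotv n (x : 'cV[R]_n) : sqnorm x = dotv x x.
Proof. by rewrite dotvE; apply: eq_bigr => i _; rewrite expr2. Qed.

Lemma consv0 n (x : RM) (y : 'cV[R]_n) : consv (x, y) ord0 0 = x.
Proof. by rewrite mxE unlift_none. Qed.

Lemma consvS n (x : RM) (y : 'cV[R]_n) i : consv (x, y) (lift ord0 i) 0 = y i 0.
Proof. by rewrite mxE liftK. Qed.

Lemma row'_consv n (x : RM) (y : 'cV[R]_n) : row' ord0 (consv (x, y)) = y.
Proof. by apply/colP => i; rewrite mxE consvS. Qed.

Lemma consv_head_tail n (x : 'cV[R]_n.+1) : consv (x ord0 0 : RM, row' ord0 x) = x.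
Proof.
apply/colP => i; rewrite mxE; case: unliftP => [k|] -> //=.
by rewrite mxE.
Qed.

Lemma consvD n (x x' : RM) (y y' : 'cV[R]_n) :
  consv (x, y) + consv (x', y') = consv ((x + x')%R : RM, y + y').
Proof.
by apply/colP => i; rewrite !mxE; case: unliftP => [k|] _ //=; rewrite mxE.
Qed.

Lemma dotv_consv n (x x' : RM) (y y' : 'cV[R]_n) :
  dotv (consv (x, y)) (consv (x', y')) = (x : R) * x' + dotv y y'.
Proof.
rewrite !dotvE big_ord_recl !consv0; congr (_ + _).
by apply: eq_bigr => i _; rewrite !consvS.
Qed.

Lemma sqnorm_consv n (x : RM) (y : 'cV[R]_n) :
  sqnorm (consv (x, y)) = (x : R) ^+ 2 + sqnorm y.
Proof. by rewrite !sqnorm_dotv dotv_consv expr2. Qed.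

Lemma sqnorm_ge0 n (x : 'cV[R]_n) : 0 <= sqnorm x.
Proof. by apply: sumr_ge0 => i _; exact: sqr_ge0. Qed.

Lemma dotv_pad2 n (x y : 'cV[R]_n) : dotv (pad2 x) (pad2 y) = dotv x y.
Proof. by rewrite !dotv_consv mulr0 !add0r. Qed.

Lemma sqnorm_pad2 n (x : 'cV[R]_n) : sqnorm (pad2 x) = sqnorm x.
Proof. by rewrite !sqnorm_dotv dotv_pad2. Qed.

Lemma dotvDr n (a x y : 'cV[R]_n) : dotv a (x + y) = dotv a x + dotv a y.
Proof. by rewrite /dotv mulmxDr mxE. Qed.

Lemma dotvDl n (a x y : 'cV[R]_n) : dotv (x + y) a = dotv x a + dotv y a.
Proof. by rewrite /dotv linearD/= mulmxDl mxE. Qed.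

Lemma dotvZl n k (a x : 'cV[R]_n) : dotv (k *: x) a = k * dotv x a.
Proof. by rewrite /dotv linearZ/= -scalemxAl mxE. Qed.

Lemma dotvC n (a b : 'cV[R]_n) : dotv a b = dotv b a.
Proof. by rewrite !dotvE; apply: eq_bigr => i _; rewrite mulrC. Qed.

Lemma dotv_mulmx m n (O : 'M[R]_(m, n)) (a : 'cV[R]_m) (x : 'cV[R]_n) :
  dotv a (O *m x) = dotv (O^T *m a) x.
Proof. by rewrite /dotv trmx_mul trmxK mulmxA. Qed.

Lemma measurable_dotv n (a : 'cV[R]_n) : measurable_fun setT (dotv a).
Proof. exact: measurableT_comp (measurable_mx_coor 0 0) (measurable_mulmx a^T). Qed.

Lemma measurable_inball n c : measurable_fun setT (@inball n c).
Proof.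
apply: measurable_fun_boolr; apply: measurable_fun_ler => //.
Qed.

Lemma measurable_row' n : measurable_fun setT (fun x : 'cV[R]_n.+1 => row' ord0 x).
Proof.
apply/measurable_fun_mxP => i j; under eq_fun do rewrite mxE.
exact: measurable_mx_coor.
Qed.

End vectors.

Section stein.
Context {R : realType}.
Local Notation RM := (measurableTypeR R).
Local Notation N := (normal_prob (0:R) 1).

Lemma integral_std_normalSC n (M : R) (f : 'cV[R]_n.+1 -> R) :
  measurable_fun setT f -> (forall z, `|f z| <= M) ->
  (\int[std_normal n.+1]_z (f z)%:E =
   \int[std_normal n]_y \int[N]_x (f (consv (x, y)))%:E)%E.
Proof.
move=> mf fM /=.
have mfc := measurableT_comp mf (@measurable_consv R n).
have ifc := @bounded_integrable _ _ _ (N \x std_normal n)%E M _ mfc (fun=> fM _).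
rewrite integral_distribution//; last exact/measurable_EFinP.
exact/esym/(@integral21_prod_meas1 _ _ _ _ _ N (std_normal n) _ ifc).
Qed.

Lemma inball01 n c (x : 'cV[R]_n) : 0 <= inball c x <= 1.
Proof. by rewrite /inball; case: (sqnorm x <= c); rewrite ?ler01 ?lexx. Qed.

Lemma chi2_2_cdf_le_inball n c (x : 'cV[R]_n) : chi2_2_cdf (c - sqnorm x) <= inball c x.
Proof.
rewrite /inball; case: (leP (sqnorm x) c) => [_|cx]; first by rewrite chi2_2_cdf_le1.
by rewrite chi2_2_cdf_lt0// subr_lt0.
Qed.

(* On the ball the square of a coordinate is at most [`|c|], hence the coordinate
   itself is at most [1 + `|c|]. *)
Let coordinate_bound n c (x : 'cV[R]_n.+1) :
  inball c x * `|x ord0 0| <= inball c x * (1 + `|c|).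
Proof.
rewrite /inball; case: (leP (sqnorm x) c) => [xc|_]; last by rewrite !mul0r.
rewrite !mul1r; have : x ord0 0 ^+ 2 <= `|c|.
  rewrite (le_trans _ (ler_norm c))// (le_trans _ xc)//.
  by rewrite -[x in sqnorm x]consv_head_tail sqnorm_consv lerDl sqnorm_ge0.
have := normr_ge0 (x ord0 0); rewrite -real_normK ?num_real//.
by move: `|x ord0 0| `|c| => u v; nra.
Qed.

(** [normal_stein_chi2] in the first coordinate, the others being fixed: then
    [c] is replaced by [c] minus the sum of their squares. *)
Lemma stein_chi2_coordinate n (al be c : R) (theta : 'cV[R]_n.+1) :
  (\int[std_normal n.+1]_z (inball c (theta + z) *
     ((theta + z) ord0 0 * (al + be * (theta + z) ord0 0)))%:E =
   \int[std_normal n.+1]_z (chi2_2_cdf (c - sqnorm (theta + z)) *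
     (be + theta ord0 0 * (al + be * (theta + z) ord0 0)))%:E)%E.
Proof.
pose t : R := theta ord0 0.
pose A (z : 'cV[R]_n.+1) : R :=
  inball c (theta + z) * ((theta + z) ord0 0 * (al + be * (theta + z) ord0 0)).
pose B (z : 'cV[R]_n.+1) : R :=
  chi2_2_cdf (c - sqnorm (theta + z)) * (be + t * (al + be * (theta + z) ord0 0)).
change ((\int[std_normal n.+1]_z (A z)%:E = \int[std_normal n.+1]_z (B z)%:E)%E).
have mX := measurable_addmx theta.
have mX0 : measurable_fun setT (fun z => (theta + z) ord0 0).
  exact: measurableT_comp (measurable_mx_coor ord0 0) mX.
have mpsi : measurable_fun setT (fun z => al + be * (theta + z) ord0 0).
  by apply: measurable_funD => //; apply: measurable_funM.
have mA : measurable_fun setT A.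
  apply: measurable_funM; last by apply: measurable_funM.
  exact: measurableT_comp (@measurable_inball _ _ c) mX.
have mB : measurable_fun setT B.
  apply: measurable_funM; last first.
    by apply: measurable_funD => //; apply: measurable_funM.
  apply: measurableT_comp (@measurable_chi2_2_cdf R) _.
  apply: measurable_funB => //; exact: measurableT_comp (@measurable_sqnorm R _) mX.
pose L : R := `|al| + `|be| * (1 + `|c|).
have L0 : 0 <= L by rewrite addr_ge0// mulr_ge0// addr_ge0.
have psi_bound k u : 0 <= k -> k <= 1 -> k * `|u| <= k * (1 + `|c|) -> k * `|al + be * u| <= L.
  move=> k0 k1 ku; rewrite (le_trans (ler_wpM2l k0 (ler_normD _ _)))// mulrDr lerD//.
    by rewrite ler_piMl.
  rewrite normrM mulrCA ler_wpM2l// (le_trans ku)// ler_piMl// addr_ge0//.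
have in0 z : 0 <= inball c z :> R by case/andP: (inball01 c z).
have in1 z : inball c z <= 1 :> R by case/andP: (inball01 c z).
have inin z : inball c z * inball c z = inball c z :> R.
  by rewrite /inball; case: (sqnorm z <= c); rewrite ?mulr1 ?mulr0.
have AM z : `|A z| <= (1 + `|c|) * L.
  rewrite /A !normrM ger0_norm// -inin mulrACA ler_pM ?mulr_ge0//.
    by rewrite (le_trans (coordinate_bound _ _))// ler_piMl// addr_ge0.
  exact/psi_bound/coordinate_bound.
have BM z : `|B z| <= `|be| + `|t| * L.
  rewrite /B normrM (ger0_norm (chi2_2_cdf_ge0 _)).
  rewrite (le_trans (ler_wpM2r _ (chi2_2_cdf_le_inball _ _)))//.
  rewrite (le_trans (ler_wpM2l (in0 _ _) (ler_normD _ _)))// mulrDr lerD ?ler_piMl//.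
  by rewrite normrM mulrCA ler_wpM2l//; exact/psi_bound/coordinate_bound.
have iA := bounded_integrable (std_normal n.+1) mA AM.
have iB := bounded_integrable (std_normal n.+1) mB BM.
have /eqP : (\int[std_normal n.+1]_z (A z - B z)%:E = 0)%E.
  have mAB : measurable_fun setT (fun z => A z - B z) by exact: measurable_funB.
  rewrite (@integral_std_normalSC _ ((1 + `|c|) * L + (`|be| + `|t| * L)))//; last first.
    by move=> z; rewrite (le_trans (ler_normB _ _))// lerD.
  rewrite integral0_eq// => y _.
  rewrite -[RHS](normal_stein_chi2 al be t (c - sqnorm (row' ord0 theta + y))).
  apply: eq_integral => x _.
  rewrite /A /B -[in theta + _](consv_head_tail theta) consvD -/t consv0 /inball.
  by rewrite sqnorm_consv -lerBrDr opprD addrA (addrAC c).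
under eq_integral do rewrite EFinB.
rewrite integralB_EFin//.
have /fineK <- := integrable_fin_num measurableT iA.
have /fineK <- := integrable_fin_num measurableT iB.
by rewrite -EFinB eqe subr_eq0 => /eqP ->.
Qed.

End stein.

Section two_more_dimensions.
Context {R : realType}.
Local Notation RM := (measurableTypeR R).
Local Notation N := (normal_prob (0:R) 1).

Lemma inball_ge0 n c (x : 'cV[R]_n) : 0 <= inball c x.
Proof. by rewrite ler0n. Qed.

Lemma pad2D n (theta y : 'cV[R]_n) (x1 x2 : RM) :
  pad2 theta + consv (x1, consv (x2, y)) = consv (x1, consv (x2, theta + y)).
Proof. by rewrite /pad2 !consvD !add0r. Qed.

Let ge0_case n c (theta : 'cV[R]_n) (h : 'cV[R]_n -> \bar R) :
  measurable_fun setT h -> (forall z, 0 <= h z)%E ->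
  (\int[std_normal n.+2]_v ((inball c (pad2 theta + v))%:E * h (row' ord0 (row' ord0 v))) =
   \int[std_normal n]_z ((chi2_2_cdf (c - sqnorm (theta + z)))%:E * h z))%E.
Proof.
move=> mh h0.
pose g (v : 'cV[R]_n.+2) : \bar R :=
  ((inball c (pad2 theta + v))%:E * h (row' ord0 (row' ord0 v)))%E.
have mg : measurable_fun setT g.
  apply: emeasurable_funM.
    apply/measurable_EFinP; exact: measurableT_comp (@measurable_inball _ _ c) (measurable_addmx _).
  apply: (measurableT_comp mh).
  exact: measurableT_comp (@measurable_row' _ _) (@measurable_row' _ _).
have g0 v : (0 <= g v)%E by rewrite mule_ge0// lee_fin inball_ge0.
rewrite ge0_integral_std_normalS//.
pose G (w : (RM * 'cV[R]_n) * RM) : \bar R := g (consv (w.1.1, consv (w.2, w.1.2))).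
have mG : measurable_fun setT G.
  apply: (measurableT_comp mg); apply: (measurableT_comp (@measurable_consv R n.+1)).
  apply/measurable_fun_pair => /=; first exact: measurableT_comp measurable_fst measurable_fst.
  apply: (measurableT_comp (@measurable_consv R n)).
  apply/measurable_fun_pair => //=; exact: measurableT_comp measurable_snd measurable_fst.
have G0 w : (0 <= G w)%E by exact: g0.
transitivity (\int[N]_x1 \int[std_normal n]_y \int[N]_x2 G ((x1, y), x2))%E.
  apply: eq_integral => x1 _.
  apply: (ge0_integral_std_normalSC (f := fun v => g (consv (x1, v)))) => [|z]; last exact: g0.
  exact: (measurableT_comp mg (measurableT_comp (@measurable_consv R n.+1) (measurable_pair1 x1))).
pose K (w : RM * 'cV[R]_n) : \bar R := (\int[N]_x2 G (w, x2))%E.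
have mK : measurable_fun setT K.
  exact: (@measurable_fun_fubini_tonelli_F _ _ _ _ _ N G mG G0).
have K0 w : (0 <= K w)%E by apply: integral_ge0.
transitivity (\int[std_normal n]_y \int[N]_x1 K (x1, y))%E.
  exact: (@fubini_tonelli _ _ _ _ _ N (std_normal n) K mK K0).
apply: eq_integral => y _; rewrite /K /G /=.
have mball : measurable_fun setT
    (fun z : RM * RM => (z.1 ^+ 2 + z.2 ^+ 2 <= c - sqnorm (theta + y))%R%:R : R).
  apply: measurable_fun_boolr; apply: measurable_fun_ler => //.
  by apply: measurable_funD; apply: measurable_funX.
transitivity (\int[N]_x1 \int[N]_x2
    (((x1 ^+ 2 + x2 ^+ 2 <= c - sqnorm (theta + y))%R%:R)%:E * h y))%E.
  apply: eq_integral => x1 _; apply: eq_integral => x2 _.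
  rewrite /g pad2D !row'_consv /inball !sqnorm_consv addrA.
  by congr ((nat_of_bool _)%:R%:E * _)%E; rewrite lerBrDr.
transitivity (\int[N]_x1
    ((\int[N]_x2 ((x1 ^+ 2 + x2 ^+ 2 <= c - sqnorm (theta + y))%R%:R)%:E) * h y))%E.
  apply: eq_integral => x1 _; rewrite ge0_integralZr//=.
  apply/measurable_EFinP; exact: measurableT_comp mball (measurable_pair1 (x1 : RM)).
rewrite ge0_integralZr//; last 2 first.
- pose b (z : RM * RM) := ((z.1 ^+ 2 + z.2 ^+ 2 <= c - sqnorm (theta + y))%R%:R : R)%:E.
  have mb : measurable_fun setT b by exact/measurable_EFinP.
  have b0 z : (0 <= b z)%E by rewrite lee_fin.
  exact: (@measurable_fun_fubini_tonelli_F _ _ _ _ _ N b mb b0).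
- by move=> x1 _; apply: integral_ge0 => x2 _; rewrite lee_fin.
by rewrite normal2_disk.
Qed.

(** Integrating out the two extra coordinates produces the distribution
    function of their squared norm. *)
Lemma integral_two_more_dimensions n c (theta : 'cV[R]_n) (h : 'cV[R]_n -> \bar R) :
  measurable_fun setT h ->
  (\int[std_normal n.+2]_v ((inball c (pad2 theta + v))%:E * h (row' ord0 (row' ord0 v))) =
   \int[std_normal n]_z ((chi2_2_cdf (c - sqnorm (theta + z)))%:E * h z))%E.
Proof.
move=> mh; rewrite integralE [RHS]integralE; congr (_ - _)%E.
  apply: etrans (etrans _ (@ge0_case n c theta (h^\+)%E _ _)) _ => //.
  - apply: eq_integral => v _; rewrite !funeposE maxe_pMr ?mule0 ?lee_fin ?inball_ge0//.
  - exact: measurable_funepos.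
  - by apply: eq_integral => v _; rewrite !funeposE maxe_pMr ?mule0 ?lee_fin ?chi2_2_cdf_ge0.
apply: etrans (etrans _ (@ge0_case n c theta (h^\-)%E _ _)) _ => //.
- by apply: eq_integral => v _; rewrite !funenegE maxe_pMr ?mule0 ?muleN ?lee_fin ?inball_ge0.
- exact: measurable_funeneg.
- by apply: eq_integral => v _; rewrite !funenegE maxe_pMr ?mule0 ?muleN ?lee_fin ?chi2_2_cdf_ge0.
Qed.

End two_more_dimensions.

Section directions.
Context {R : realType}.
Local Notation RM := (measurableTypeR R).

Lemma integral_orthonormal_rows l k (B : 'M[R]_(l, k)) (f : 'cV[R]_l -> \bar R) :
  B *m B^T = 1%:M -> measurable_fun setT f ->
  (\int[std_normal k]_z f (B *m z) = \int[std_normal l]_z f z)%E.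
Proof.
move=> BB; apply: (same_law_integral (phi1 := mulmx B) (phi2 := id)) => g mg g0.
exact: std_normal_orthonormal_rows.
Qed.

Lemma rotate_direction n (a : 'cV[R]_n.+1) : dotv a a = 1 ->
  exists O O' : 'M[R]_n.+1, [/\ O *m O' = 1%:M, O *m O^T = 1%:M,
    forall y, sqnorm (O *m y) = sqnorm y, forall y, dotv a (O *m y) = y ord0 0 &
    O' *m a = delta_mx ord0 0].
Proof.
move=> a1.
have aa : a^T *m a^T^T = 1%:M.
  by rewrite trmxK [LHS]mx11_scalar -/(dotv a a) a1.
have [ O [OO aO _]] := std_normal_rotate_to_axis aa.
exists O, O^T; split => //; last first.
- by rewrite -[LHS]trmxK trmx_mul trmxK aO trmx_delta.
- move=> y.
  rewrite /dotv mulmxA aO mxE big_ord_recl big1 ?addr0; last first.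
    by move=> i _; rewrite mxE /= mul0r.
  by rewrite mxE !eqxx mul1r.
- by move=> y; rewrite !sqnorm_dotv dotv_mulmx mulmxA (mulmx1C OO) mul1mx.
Qed.

(** Any unit vector [a] is reduced to the first axis by a rotation, which
    changes [theta] but neither norms nor [dotv a theta]. *)
Lemma stein_chi2_direction n (al be c : R) (a theta : 'cV[R]_n.+1) : dotv a a = 1 ->
  (\int[std_normal n.+1]_z (inball c (theta + z) *
     (dotv a (theta + z) * (al + be * dotv a (theta + z))))%:E =
   \int[std_normal n.+1]_z (chi2_2_cdf (c - sqnorm (theta + z)) *
     (be + dotv a theta * (al + be * dotv a (theta + z))))%:E)%E.
Proof.
move=> a1; have [ O [ O' [OO' OO Osq Oa _]]] := rotate_direction a1.
have mX := measurable_addmx theta.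
have mdot := measurableT_comp (@measurable_dotv _ _ a) mX.
have maff u v : measurable_fun setT (fun z : 'cV[R]_n.+1 => u + v * dotv a (theta + z)).
  by apply: measurable_funD => //; apply: measurable_funM.
have XE z : theta + O *m z = O *m (O' *m theta + z).
  by rewrite mulmxDr mulmxA OO' mul1mx.
rewrite -(integral_orthonormal_rows OO); last first.
  apply/measurable_EFinP; apply: measurable_funM; last by apply: measurable_funM.
  exact: measurableT_comp (@measurable_inball _ _ c) mX.
rewrite -[RHS](integral_orthonormal_rows OO); last first.
  apply/measurable_EFinP; apply: measurable_funM; last first.
    by apply: measurable_funD => //; apply: measurable_funM.
  apply: measurableT_comp (@measurable_chi2_2_cdf R) _.
  apply: measurable_funB => //; exact: measurableT_comp (@measurable_sqnorm R _) mX.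
under eq_integral do rewrite XE Oa /inball Osq.
under [RHS]eq_integral do rewrite XE Oa Osq.
have -> : dotv a theta = (O' *m theta) ord0 0 by rewrite -Oa mulmxA OO' mul1mx.
exact: stein_chi2_coordinate.
Qed.

Lemma dotv_pad2_l n (a : 'cV[R]_n) (v : 'cV[R]_n.+2) :
  dotv (pad2 a) v = dotv a (row' ord0 (row' ord0 v)).
Proof.
rewrite -[in LHS](consv_head_tail v) -[in LHS](consv_head_tail (row' ord0 v)).
by rewrite /pad2 !dotv_consv !mul0r !add0r.
Qed.

(** The factor [chi2_2_cdf] produced by the integration by parts is absorbed by
    two more coordinates: this is where the degrees of freedom increase. *)
Lemma stein_two_more_dimensions n (al be c : R) (a theta : 'cV[R]_n.+1) : dotv a a = 1 ->
  (\int[std_normal n.+1]_z (inball c (theta + z) *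
     (dotv a (theta + z) * (al + be * dotv a (theta + z))))%:E =
   \int[std_normal n.+3]_v (inball c (pad2 theta + v) *
     (be + dotv a theta * (al + be * dotv (pad2 a) (pad2 theta + v))))%:E)%E.
Proof.
move=> a1; rewrite stein_chi2_direction//.
under eq_integral do rewrite EFinM.
pose h (z : 'cV[R]_n.+1) := (be + dotv a theta * (al + be * dotv a (theta + z)))%:E.
have mh : measurable_fun setT h.
  apply/measurable_EFinP; apply: measurable_funD => //; apply: measurable_funM => //.
  apply: measurable_funD => //; apply: measurable_funM => //.
  exact: measurableT_comp (@measurable_dotv _ _ a) (measurable_addmx theta).
rewrite -(integral_two_more_dimensions c theta mh).
apply: eq_integral => v _; rewrite -EFinM; congr (_ * (_ + _ * (_ + _ * _)))%:E.
by rewrite !dotvDr dotv_pad2 dotv_pad2_l.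
Qed.

Lemma dotv_polar n (a : 'cV[R]_n.+1) : exists u : 'cV[R]_n.+1,
  dotv u u = 1 /\ a = Num.sqrt (sqnorm a) *: u.
Proof.
have [u [u1 au]] := row_polar a^T.
exists u^T; split; first by rewrite /dotv trmxK u1 mxE eqxx.
rewrite -[LHS]trmxK au linearZ/=; congr (Num.sqrt _ *: _).
by apply: eq_bigr => i _; rewrite mxE.
Qed.

Lemma dotvZr n k (a x : 'cV[R]_n) : dotv x (k *: a) = k * dotv x a.
Proof. by rewrite dotvC dotvZl dotvC. Qed.

(** A rotation carries a mean vector to its norm times the first axis, so that
    the noncentral chi-square law depends on this norm only. *)
Lemma ball_measure_sqnorm n c (m m' : 'cV[R]_n.+1) : sqnorm m = sqnorm m' ->
  (\int[std_normal n.+1]_z (inball c (m + z))%:E =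
   \int[std_normal n.+1]_z (inball c (m' + z))%:E)%E.
Proof.
pose e : 'cV[R]_n.+1 := delta_mx ord0 0.
suff axis (v : 'cV[R]_n.+1) : (\int[std_normal n.+1]_z (inball c (v + z))%:E =
    \int[std_normal n.+1]_z (inball c (Num.sqrt (sqnorm v) *: e + z))%:E)%E.
  by move=> mm; rewrite axis [RHS]axis mm.
have [u [u1 vE]] := dotv_polar v.
have [ O [ O' [OO' OO Osq _ O'u]]] := rotate_direction u1.
rewrite -(integral_orthonormal_rows OO); last first.
  apply/measurable_EFinP.
  exact: measurableT_comp (@measurable_inball _ _ c) (measurable_addmx v).
apply: eq_integral => z _; rewrite /inball /e -O'u -[sqnorm (_ *: _ + _)]Osq.
by rewrite mulmxDr -scalemxAr mulmxA OO' mul1mx -vE.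

Qed.

Lemma cvg_integral_inball n (f : 'cV[R]_n -> R) :
  measurable_fun setT f -> (forall z, 0 <= f z) ->
  (\int[std_normal n]_z (inball k%:R z * f z)%:E)%E @[k --> \oo] -->
  (\int[std_normal n]_z (f z)%:E)%E.
Proof.
move=> mf f0; pose g (k : nat) (z : 'cV[R]_n) := (inball k%:R z * f z)%:E.
have gE z : limn (g ^~ z) = (f z)%:E.
  apply/cvg_lim => //; apply: cvg_near_cst.
  near=> k; rewrite /g /inball (_ : (_ <= _) = true) ?mul1r//.
  near: k; exact: nbhs_infty_ger.
under [X in _ --> X]eq_integral do rewrite -gE.
apply: (@cvg_monotone_convergence _ _ _ (std_normal n) setT measurableT g) => //.
- move=> k; apply/measurable_EFinP; apply: measurable_funM => //.
  exact: measurable_inball.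
- by move=> k z _; rewrite lee_fin mulr_ge0// inball_ge0.
- move=> z _ k l kl; rewrite lee_fin ler_wpM2r//.
  rewrite /inball; case: (leP (sqnorm z) k%:R) => [zk|_]; last by rewrite ler0n.
  by rewrite (le_trans zk)// ler_nat.
Unshelve. all: end_near. Qed.

End directions.

(** * Moments outside a ball *)

Section integrable_real.
Context d (T : measurableType d) (R : realType) (P : probability T R).
Implicit Types f g h : T -> R.
Local Notation integrableR f := (P.-integrable setT (EFin \o f)).

Lemma integrableR_D f g : integrableR f -> integrableR g ->
  integrableR (fun x => f x + g x).
Proof. by move=> fi gi; exact: (integrableD measurableT fi gi). Qed.

Lemma integrableR_Z k f : integrableR f -> integrableR (fun x => k * f x).
Proof. by move=> fi; exact: (integrableZl measurableT k fi). Qed.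

Lemma integrableR_cst k : integrableR (fun=> k).
Proof. exact: finite_measure_integrable_cst. Qed.

Lemma integrableR_le f g : measurable_fun setT f -> (forall x, `|f x| <= g x) ->
  integrableR g -> integrableR f.
Proof.
move=> mf fg; apply: le_integrable => //; first exact/measurable_EFinP.
by move=> x _; rewrite /= lee_fin (le_trans (fg x))// ler_norm.
Qed.

Lemma integrableR_measurable f : integrableR f -> measurable_fun setT f.
Proof. by move=> /measurable_int /measurable_EFinP. Qed.

Lemma integrableR_cut h f : measurable_fun setT h -> (forall x, 0 <= h x <= 1) ->
  integrableR f -> integrableR (fun x => h x * f x).
Proof.
move=> mh h01 fi; have mf := integrableR_measurable fi.
apply: (integrableR_le (g := fun x => `|f x|)).
- exact: measurable_funM.
- move=> x; have /andP[h0 h1] := h01 x.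
  by rewrite normrM ger0_norm// ler_piMl.
- exact: integrable_norm fi.
Qed.

Lemma integrableR_sqr f : measurable_fun setT f -> integrableR (fun x => f x ^+ 2) ->
  integrableR f.
Proof.
move=> mf f2; apply: (integrableR_le (g := fun x => 1 + f x ^+ 2)) => //.
  move=> x; rewrite -[f x ^+ 2]real_normK ?num_real//.
  by have := normr_ge0 (f x); move: `|f x| => u; nra.
by apply: integrableR_D => //; exact: integrableR_cst.
Qed.

Lemma integrableR_mul f g : measurable_fun setT f -> measurable_fun setT g ->
  integrableR (fun x => f x ^+ 2) -> integrableR (fun x => g x ^+ 2) ->
  integrableR (fun x => f x * g x).
Proof.
move=> mf mg f2 g2; apply: (integrableR_le (g := fun x => f x ^+ 2 + g x ^+ 2)).
- exact: measurable_funM.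
- move=> x; rewrite normrM -[f x ^+ 2]real_normK ?num_real// -[g x ^+ 2]real_normK ?num_real//.
  by move: `|f x| `|g x| => u v; nra.
- exact: integrableR_D.
Qed.

Lemma Rintegral_prob_cst k : \int[P]_x k = k.
Proof.
rewrite Rintegral_cst// -[RHS]mulr1; congr (_ * _).
exact: (congr1 fine (probability_setT P)).
Qed.

Lemma Rintegral_affine_sqr f (u v : R) : measurable_fun setT f ->
  integrableR (fun x => f x ^+ 2) ->
  integrableR (fun x => (u + v * f x) ^+ 2) /\
  \int[P]_x ((u + v * f x) ^+ 2) =
  u ^+ 2 + 2 * u * v * \int[P]_x f x + v ^+ 2 * \int[P]_x (f x ^+ 2).
Proof.
move=> mf f2; have f1 := integrableR_sqr mf f2.
have E : (fun x => (u + v * f x) ^+ 2) = (fun x => (u ^+ 2 + 2 * u * v * f x) + v ^+ 2 * f x ^+ 2).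
  by apply/funext => x; ring.
have i1 : integrableR (fun x => u ^+ 2 + 2 * u * v * f x).
  by apply: integrableR_D; [exact: integrableR_cst|exact: integrableR_Z].
have i2 : integrableR (fun x => v ^+ 2 * f x ^+ 2) by exact: integrableR_Z.
rewrite E; split; first exact: integrableR_D.
rewrite RintegralD// RintegralD//; last 2 first.
- exact: integrableR_cst.
- exact: integrableR_Z.
by rewrite Rintegral_prob_cst !RintegralZl.
Qed.

End integrable_real.

Section moments.
Context {R : realType}.
Local Notation integrableR n f := ((@std_normal R n).-integrable setT (EFin \o f)).

Lemma pad20 n : pad2 (0 : 'cV[R]_n) = 0.
Proof.
apply/colP => i; rewrite !mxE; case: unliftP => [k|] _ //=.
by rewrite !mxE; case: unliftP => [l|] _ //=; rewrite mxE.
Qed.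

(* With [theta = 0] and [psi x = x], the integration by parts compares the second
   moment on a ball with the measure of that ball in dimension [n + 3]; the
   radius is then sent to infinity. *)
Let integral_sqr_unit n (a : 'cV[R]_n.+1) : dotv a a = 1 ->
  (\int[std_normal n.+1]_z (dotv a z ^+ 2)%:E = 1)%E.
Proof.
move=> a1.
have mdot := measurable_dotv a.
have c1 := cvg_integral_inball (measurable_funX 2 mdot) (fun z => sqr_ge0 (dotv a z)).
have c2 := @cvg_integral_inball R n.+3 (cst 1) (measurable_cst _) (fun=> ler01).
move: c2; rewrite [X in _ --> X](_ : _ = 1%E); last first.
  apply: (etrans (integral_cst (@std_normal R n.+3) measurableT 1%:E)).
  by rewrite mul1e; exact: (probability_setT (@std_normal R n.+3)).
move=> c2; apply: (cvg_unique _ c1); rewrite //=.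
apply: cvg_trans c2; apply: near_eq_cvg; apply: nearW => k /=.
have := @stein_two_more_dimensions _ n 0 1 k%:R a 0 a1.
rewrite pad20 /dotv mulmx0 mxE.
under eq_integral do rewrite !add0r mul1r.
under [X in _ = X -> _]eq_integral do rewrite !add0r mul0r addr0.
by under [X in _ -> _ = X]eq_integral do rewrite expr2.
Qed.

Lemma dotv_moments n (a : 'cV[R]_n.+1) : [/\ integrableR n.+1 (fun z => dotv a z ^+ 2),
  \int[std_normal n.+1]_z dotv a z = 0 &
  \int[std_normal n.+1]_z (dotv a z ^+ 2) = dotv a a].
Proof.
have [u [u1 ->]] := dotv_polar a; set s := Num.sqrt _.
have i2 : integrableR n.+1 (fun z => dotv u z ^+ 2).
  apply/integrableP; split.
    by apply/measurable_EFinP; apply: measurable_funX; exact: measurable_dotv.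
  under eq_integral do rewrite /= ger0_norm ?sqr_ge0//.
  by rewrite integral_sqr_unit// ltry.
have i1 := integrableR_sqr (measurable_dotv u) i2.
have z1 : \int[std_normal n.+1]_z dotv u z = 0.
  have NN : - 1%:M *m (- 1%:M)^T = 1%:M :> 'M[R]_n.+1.
    by rewrite linearN/= trmx1 mulNmx mulmxN opprK mulmx1.
  have mE : measurable_fun setT (fun z => (dotv u z)%:E).
    by apply/measurable_EFinP; exact: measurable_dotv.
  have : \int[std_normal n.+1]_z dotv u (- 1%:M *m z) = \int[std_normal n.+1]_z dotv u z.
    exact: (congr1 fine (integral_orthonormal_rows NN mE)).
  under eq_Rintegral do rewrite mulNmx mul1mx -[- _]scaleN1r dotvZr.
  by rewrite RintegralZl// => /eqP; rewrite mulN1r eq_sym -addr_eq0 -mulr2n mulrn_eq0/= => /eqP.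
have E z : dotv (s *: u) z = 0 + s * dotv u z by rewrite dotvZl add0r.
have [i2' s2] := Rintegral_affine_sqr 0 s (measurable_dotv u) i2.
split.
- rewrite (_ : (fun z => _) = (fun z => (0 + s * dotv u z) ^+ 2))//.
  by apply/funext => z; rewrite E.
- by under eq_Rintegral do rewrite dotvZl; rewrite RintegralZl// z1 mulr0.
- under eq_Rintegral do rewrite E; rewrite s2 /Rintegral integral_sqr_unit//=.
  by rewrite dotvZl dotvZr u1 expr0n/= mulr0 mul0r mul0r add0r add0r mulr1 mulr1 expr2.
Qed.

Lemma dotv_shifted_moments n (a theta : 'cV[R]_n.+1) :
  [/\ integrableR n.+1 (fun z => dotv a (theta + z) ^+ 2),
  \int[std_normal n.+1]_z dotv a (theta + z) = dotv a theta &
  \int[std_normal n.+1]_z (dotv a (theta + z) ^+ 2) = dotv a a + dotv a theta ^+ 2].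
Proof.
have [i2 z1 s1] := dotv_moments a.
have i1 := integrableR_sqr (measurable_dotv a) i2.
have [i2' s2] := Rintegral_affine_sqr (dotv a theta) 1 (measurable_dotv a) i2.
have E z : dotv a (theta + z) = dotv a theta + 1 * dotv a z by rewrite dotvDr mul1r.
split.
- rewrite (_ : (fun z => _) = (fun z => (dotv a theta + 1 * dotv a z) ^+ 2))//.
  by apply/funext => z; rewrite E.
- under eq_Rintegral do rewrite dotvDr.
  rewrite RintegralD//; last exact: integrableR_cst.
  by rewrite Rintegral_prob_cst z1 addr0.
- under eq_Rintegral do rewrite E.
  by rewrite s2 z1 s1 mulr0 addr0 expr1n mul1r addrC.
Qed.

End moments.

Section tail_moments.
Context {R : realType}.
Local Notation integrableR n f := ((@std_normal R n).-integrable setT (EFin \o f)).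

(** The value at [c] of the distribution function of the noncentral chi-square
    law with [n] degrees of freedom and noncentrality [sqnorm theta]. *)
Definition ball_prob n (c : R) (theta : 'cV[R]_n) : R :=
  \int[std_normal n]_z inball c (theta + z).

Let measurable_inballX n c (theta : 'cV[R]_n) :
  measurable_fun setT (fun z => inball c (theta + z)).
Proof. exact: measurableT_comp (@measurable_inball _ _ c) (measurable_addmx theta). Qed.

Let measurable_dotX n (a theta : 'cV[R]_n) :
  measurable_fun setT (fun z => dotv a (theta + z)).
Proof. exact: measurableT_comp (@measurable_dotv _ _ a) (measurable_addmx theta). Qed.

Lemma integrable_inball n c (theta : 'cV[R]_n) :
  integrableR n (fun z => inball c (theta + z)).
Proof.
apply: (@bounded_integrable _ _ _ _ 1 _ (measurable_inballX c theta)) => z.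
by have /andP[i0 i1] := inball01 c (theta + z); rewrite ger0_norm.
Qed.

Lemma integrable_inball_mul n c (theta : 'cV[R]_n) (f : 'cV[R]_n -> R) :
  integrableR n f -> integrableR n (fun z => inball c (theta + z) * f z).
Proof.
by apply: integrableR_cut; [exact: measurable_inballX|move=> z; exact: inball01].
Qed.

Lemma integrable_dotX n (a theta : 'cV[R]_n.+1) :
  integrableR n.+1 (fun z => dotv a (theta + z)).
Proof.
have [i2 _ _] := dotv_shifted_moments a theta.
exact: integrableR_sqr (measurable_dotX a theta) i2.
Qed.

(* [psi = 1] in the integration by parts. *)
Let trunc_mean_unit n c (u theta : 'cV[R]_n.+1) : dotv u u = 1 ->
  \int[std_normal n.+1]_z (inball c (theta + z) * dotv u (theta + z)) =
  dotv u theta * ball_prob c (pad2 theta).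
Proof.
move=> u1; have /(congr1 fine) := stein_two_more_dimensions 1 0 c theta u1.
under eq_integral do rewrite mul0r addr0 mulr1.
under [X in _ = fine X -> _]eq_integral do rewrite mul0r addr0 mulr1 add0r mulrC.
move=> E; apply: (etrans E); rewrite -/(Rintegral _ _ _).
by rewrite RintegralZl//; exact: integrable_inball.
Qed.

Let trunc_mean n c (a theta : 'cV[R]_n.+1) :
  \int[std_normal n.+1]_z (inball c (theta + z) * dotv a (theta + z)) =
  dotv a theta * ball_prob c (pad2 theta).
Proof.
have [u [u1 ->]] := dotv_polar a; set s := Num.sqrt _.
under eq_Rintegral do rewrite dotvZl mulrCA.
rewrite RintegralZl//; last first.
  by apply: integrable_inball_mul; exact: integrable_dotX.
by rewrite trunc_mean_unit// dotvZl mulrA.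
Qed.

(* [psi x = x] in the integration by parts gives [1 + t d] on the right, whose
   second term is a first moment in two more dimensions. *)
Let trunc_sqr_unit n c (u theta : 'cV[R]_n.+1) : dotv u u = 1 ->
  \int[std_normal n.+1]_z (inball c (theta + z) * dotv u (theta + z) ^+ 2) =
  ball_prob c (pad2 theta) + dotv u theta ^+ 2 * ball_prob c (pad2 (pad2 theta)).
Proof.
move=> u1; have /(congr1 fine) := stein_two_more_dimensions 0 1 c theta u1.
under eq_integral do rewrite mul1r add0r -expr2.
under [X in _ = fine X -> _]eq_integral do rewrite add0r mul1r mulrDr mulr1 mulrCA.
move=> E; apply: (etrans E).
have ii := integrable_inball c (pad2 theta).
have id : integrableR n.+3
    (fun v => inball c (pad2 theta + v) * dotv (pad2 u) (pad2 theta + v)).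
  by apply: integrable_inball_mul; exact: integrable_dotX.
rewrite -/(Rintegral _ _ _) RintegralD//; last exact: integrableR_Z.
by rewrite RintegralZl// trunc_mean dotv_pad2 mulrA -expr2.
Qed.

Let trunc_sqr n c (a theta : 'cV[R]_n.+1) :
  \int[std_normal n.+1]_z (inball c (theta + z) * dotv a (theta + z) ^+ 2) =
  dotv a a * ball_prob c (pad2 theta) +
  dotv a theta ^+ 2 * ball_prob c (pad2 (pad2 theta)).
Proof.
have [u [u1 ->]] := dotv_polar a; set s := Num.sqrt _.
under eq_Rintegral do rewrite dotvZl exprMn mulrCA.
rewrite RintegralZl//; last first.
  have [i2 _ _] := dotv_shifted_moments u theta.
  exact: integrable_inball_mul.
by rewrite trunc_sqr_unit// !dotvZl dotvZr u1 mulr1 exprMn mulrDr -expr2 mulrA.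
Qed.

(** The moments on the complement of the ball, where [X] is unbounded, are
    differences of those on the whole space and on the ball; the bilinear one
    is obtained by polarization. *)
Lemma tail_moments n c (a b theta : 'cV[R]_n.+1) :
  let w z := 1 - inball c (theta + z) in
  let X z := theta + z in
  [/\ integrableR n.+1 (fun z => w z * dotv a (X z)),
      integrableR n.+1 (fun z => w z * (dotv a (X z) * dotv b (X z))),
      \int[std_normal n.+1]_z (w z * dotv a (X z)) =
        (1 - ball_prob c (pad2 theta)) * dotv a theta &
      \int[std_normal n.+1]_z (w z * (dotv a (X z) * dotv b (X z))) =
        (1 - ball_prob c (pad2 theta)) * dotv a b +
        (1 - ball_prob c (pad2 (pad2 theta))) * (dotv a theta * dotv b theta)].
Proof.
move=> w X.
have mw : measurable_fun setT w 
  by apply: measurable_funB; [exact: measurable_cst|exact: measurable_inballX].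
have w01 z : 0 <= w z <= 1.
  by have /andP[i0 i1] := inball01 c (X z); rewrite subr_ge0 i1 lerBlDr lerDl.
have sqr_i e : integrableR n.+1 (fun z => dotv e (X z) ^+ 2).
  by have [] := dotv_shifted_moments e theta.
have wsqr_i e : integrableR n.+1 (fun z => w z * dotv e (X z) ^+ 2).
  exact: integrableR_cut.
have wsqr e : \int[std_normal n.+1]_z (w z * dotv e (X z) ^+ 2) =
    (1 - ball_prob c (pad2 theta)) * dotv e e +
    (1 - ball_prob c (pad2 (pad2 theta))) * dotv e theta ^+ 2.
  have [_ _ s2] := dotv_shifted_moments e theta.
  rewrite /w; under eq_Rintegral do rewrite mulrBl mul1r.
  rewrite RintegralB//; last exact: integrable_inball_mul.
  by rewrite s2 trunc_sqr; ring.
split.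
- by apply: integrableR_cut => //; exact: integrable_dotX.
- apply: integrableR_cut => //; apply: integrableR_mul => //; exact: measurable_dotX.
- have [_ s1 _] := dotv_shifted_moments a theta.
  rewrite /w; under eq_Rintegral do rewrite mulrBl mul1r.
  rewrite RintegralB//; last 2 first.
  + exact: integrable_dotX.
  + by apply: integrable_inball_mul; exact: integrable_dotX.
  by rewrite s1 trunc_mean; ring.
- rewrite (_ : (fun z => w z * (dotv a (X z) * dotv b (X z))) =
      (fun z => 4^-1 * (w z * dotv (a + b) (X z) ^+ 2) +
                - 4^-1 * (w z * dotv (a + -1 *: b) (X z) ^+ 2))); last first.
    by apply/funext => z; rewrite !dotvDl dotvZl; field.
  rewrite RintegralD//; [|exact: integrableR_Z..].
  rewrite !RintegralZl// !wsqr !dotvDl !dotvDr !dotvZl !dotvZr (dotvC b a).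
  by field.
Qed.

End tail_moments.

(** * Factorization of the projection *)

Section projections.
Context {R : realType}.

Lemma mxtrace_mulmx_tr m n (M : 'M[R]_(m, n)) :
  \tr (M *m M^T) = \sum_i \sum_j M i j ^+ 2.
Proof.
apply: eq_bigr => i _; rewrite mxE; apply: eq_bigr => j _.
by rewrite mxE expr2.
Qed.

Lemma mxtrace_mulmx_tr_eq0 m n (M : 'M[R]_(m, n)) : \tr (M *m M^T) = 0 -> M = 0.
Proof.
rewrite mxtrace_mulmx_tr => /eqP; rewrite psumr_eq0 => [/allP M0|i _]; last first.
  by apply: sumr_ge0 => j _; exact: sqr_ge0.
apply/matrixP => i j; rewrite mxE; apply/eqP; rewrite -sqrf_eq0.
have := M0 i; rewrite mem_index_enum => /(_ isT)/=.
rewrite psumr_eq0 => [/allP/(_ j)|k _]; last exact: sqr_ge0.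
by rewrite mem_index_enum; apply.
Qed.

(** Each step of the induction splits off a unit vector proportional to a
    nonzero column of [Q], which [Q] fixes.  The trace, which replaces the
    rank, drops by one. *)
Lemma orthogonal_projection_factor p l (Q : 'M[R]_p) :
  Q^T = Q -> Q *m Q = Q -> \tr Q = l%:R ->
  exists U : 'M[R]_(p, l), U^T *m U = 1%:M /\ U *m U^T = Q.
Proof.
elim: l Q => [|l IHl] Q Qsym Qid Qtr.
  exists 0; split; first by apply/matrixP => -[].
  by rewrite mul0mx; apply/esym/mxtrace_mulmx_tr_eq0; rewrite Qsym Qid.
have [j Qj0] : exists j, col j Q != 0.
  apply/existsP; apply: contraT => /existsPn Q0.
  have Q_eq0 : Q = 0.
    apply/matrixP => i k; have := congr1 (fun M : 'cV[R]_p => M i 0) (eqP (negbNE (Q0 k))).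
    by rewrite !mxE.
  by move: Qtr; rewrite Q_eq0 raddf0 => /eqP; rewrite eq_sym pnatr_eq0.
case: p Q Qsym Qid Qtr j Qj0 IHl => [|p] Q Qsym Qid Qtr j Qj0 IHl; first by case: j Qj0.
have [u [u1 uE]] := dotv_polar (col j Q).
set s := Num.sqrt _ in uE.
have s0 : s != 0 by apply: contra_neq Qj0 => s0; rewrite uE s0 scale0r.
have Qu : Q *m u = u.
  have -> : u = s^-1 *: (Q *m delta_mx j 0) by rewrite -colE uE scalerA mulVf// scale1r.
  by rewrite -scalemxAr mulmxA Qid.
have uQ : u^T *m Q = u^T by rewrite -[LHS]trmxK trmx_mul trmxK Qsym Qu.
have uu : u^T *m u = 1%:M by rewrite [LHS]mx11_scalar -/(dotv u u) u1.
have [U' [UU UQ]] : exists U : 'M[R]_(p.+1, l),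
    U^T *m U = 1%:M /\ U *m U^T = Q - u *m u^T.
  apply: IHl.
  - by rewrite linearB/= trmx_mul trmxK Qsym.
  - rewrite mulmxBl !mulmxBr Qid mulmxA Qu -!mulmxA uQ (mulmxA u^T u) uu mul1mx.
    by rewrite subrr subr0.
  - by rewrite linearB/= mxtrace_mulC uu mxtrace1 Qtr -natr1 addrK.
have Uu : U'^T *m u = 0.
  rewrite -[U'^T]mul1mx -UU -!mulmxA (mulmxA U') UQ mulmxBl Qu -mulmxA uu mulmx1.
  by rewrite subrr mulmx0.
exists (row_mx u U' : 'M[R]_(p.+1, 1 + l)); split.
  rewrite (@tr_row_mx _ _ 1 l) (@mul_col_row _ 1 l _ 1 l) uu UU Uu.
  by rewrite -[u^T *m U']trmxK trmx_mul trmxK Uu trmx0 -scalar_mx_block.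
by rewrite (@tr_row_mx _ _ 1 l) (@mul_row_col _ _ 1 l) UQ addrC subrK.
Qed.

(** A normal law is given by any square root [A] of its covariance; it reduces
    to the root [U] because [U^T *m A] has orthonormal rows. *)
Lemma same_gram_factor p l k (U : 'M[R]_(p, l)) (A : 'M[R]_(p, k)) :
  U^T *m U = 1%:M -> A *m A^T = U *m U^T ->
  A = U *m (U^T *m A) /\ (U^T *m A) *m (U^T *m A)^T = 1%:M.
Proof.
move=> UU AA; split; last first.
  by rewrite trmx_mul trmxK -mulmxA (mulmxA A) AA -!mulmxA UU mulmx1 UU.
apply/eqP; rewrite -subr_eq0; apply/eqP/mxtrace_mulmx_tr_eq0.
set Q := U *m U^T in AA *; have Qsym : Q^T = Q by rewrite trmx_mul trmxK.
have QQ : Q *m Q = Q by rewrite /Q mulmxA -(mulmxA U) UU mulmx1.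
rewrite mulmxA -/Q linearB/= trmx_mul Qsym mulmxBl !mulmxBr.
by rewrite !mulmxA AA -!(mulmxA Q A) AA !QQ !subrr mxtrace0.
Qed.

Lemma posdefmx_unit n (A : 'M[R]_n) : posdefmx A -> A \in unitmx.
Proof.
move=> [_ Apos]; rewrite -row_free_unit; apply: inj_row_free => v vA.
apply/eqP; apply: contraT => v0.
have := Apos v^T; rewrite trmxK vA mul0mx mxE ltxx => -> //.
by apply: contra_neq v0 => vt0; rewrite -[v]trmxK vt0 trmx0.
Qed.

Lemma gram_unit p r (Gamma : 'M[R]_p) (Upsilon : 'M[R]_(p, r)) :
  posdefmx Gamma -> \rank Upsilon = r -> Upsilon^T *m Gamma *m Upsilon \in unitmx.
Proof.
move=> [Gsym Gpos] rU; apply: posdefmx_unit; split.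
  by rewrite !trmx_mul trmxK Gsym mulmxA.
move=> v v0; rewrite -!mulmxA mulmxA -trmx_mul mulmxA; apply: Gpos.
apply: contra_neq v0 => Uv0.
have /eqP := congr1 trmx Uv0; rewrite trmx_mul trmx0 mulmx_free_eq0; last first.
  by rewrite /row_free mxrank_tr rU.
by move=> /eqP vt0; rewrite -[v]trmxK vt0 trmx0.
Qed.

Lemma Peff_perp_projection p r (Gamma S : 'M[R]_p) (Upsilon : 'M[R]_(p, r)) :
  (r <= p)%N -> posdefmx Gamma -> posdef_sqrt Gamma S -> \rank Upsilon = r ->
  let Q := Peff_perp Gamma S Upsilon in
  [/\ Q^T = Q, Q *m Q = Q & \tr Q = (p - r)%:R].
Proof.
move=> rp Gpos [[Ssym Spos] SS] rU Q.
have Mu := gram_unit Gpos rU; set M := _ *m _ *m _ in Mu.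
have Msym : M^T = M by rewrite /M !trmx_mul trmxK Gpos.1 mulmxA.
set P := Peff Gamma S Upsilon.
have Psym : P^T = P.
  by rewrite /P /Peff -/M !trmx_mul trmxK trmx_inv Msym Ssym !mulmxA.
have PP : P *m P = P.
  rewrite {1 2}/P /Peff -/M -!mulmxA (mulmxA S S) SS.
  rewrite (mulmxA Upsilon^T Gamma) (mulmxA (Upsilon^T *m Gamma)) -/M.
  by rewrite (mulmxA M) mulmxV// mul1mx /P /Peff -/M !mulmxA.
have trP : \tr P = r%:R.
  rewrite /P /Peff -/M -!mulmxA mxtrace_mulC -!mulmxA SS mxtrace_mulC -!mulmxA.
  by rewrite (mulmxA Upsilon^T) mulVmx// mxtrace1.
split.
- by rewrite /Q /Peff_perp -/P linearB/= trmx1 Psym.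
- by rewrite /Q /Peff_perp -/P mulmxBl mul1mx mulmxBr mulmx1 PP subrr subr0.
- by rewrite /Q /Peff_perp -/P linearB/= mxtrace1 trP natrB.
Qed.

End projections.

(** * Laws of the statistics *)

Section normal_laws.
Context {R : realType}.

Lemma normal_law_integral n (m : 'cV[R]_n) (Sigma : 'M[R]_n) (mu : probability 'cV[R]_n R) :
  normal_law m Sigma mu -> exists k (A : 'M[R]_(n, k)), A *m A^T = Sigma /\
    forall f : 'cV[R]_n -> \bar R, measurable_fun setT f -> (forall x, 0 <= f x)%E ->
      (\int[mu]_x f x = \int[std_normal k]_z f (m + A *m z)%R)%E.
Proof.
move=> [k [A [AA muA]]]; exists k, A; split=> // f mf f0.
have mphi : measurable_fun setT (fun z : 'cV[R]_k => m + A *m z).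
  exact: measurableT_comp (measurable_addmx m) (measurable_mulmx A).
rewrite (eq_measure_integral (measure_function_pushforward__canonical__measure_function_Measure
  (std_normal k) mphi)); last by move=> B mB _; exact: muA.
by rewrite ge0_integral_pushforward.
Qed.

Lemma noncentral_chi2_ball_prob l (eta c : R) (nu : probability R R) (theta : 'cV[R]_l.+1) :
  noncentral_chi2_law l.+1 eta nu -> sqnorm theta = eta ->
  nu [set x | x <= c] = (ball_prob c theta)%:E.
Proof.
move=> [m [mu [mulaw m_eta nuE]]] theta_eta.
have mB : measurable [set x : R | x <= c] by rewrite -set_itvNyc; exact: measurable_itv.
rewrite nuE//.
have [k [A [AA muf]]] := normal_law_integral mulaw.
have mball := @measurable_inball R l.+1 c.
have mS : measurable ((@sqnorm R l.+1) @^-1` [set x : R | x <= c]).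
  by rewrite -[X in measurable X]setTI; apply: measurable_sqnorm.
apply: (etrans (esym (etrans (integral_indic mu measurableT mS) _))); first by rewrite setIT.
rewrite (eq_integral (fun x => (inball c x)%:E)); last first.
  by move=> x _; rewrite indicE /inball; congr (nat_of_bool _)%:R%:E; 
  by apply/idP/idP => [/set_mem//|xc]; exact/mem_set.
rewrite muf; last 2 first.
- exact/measurable_EFinP.
- by move=> x; rewrite lee_fin inball_ge0.
have mballX : measurable_fun setT (fun z => (inball c (m + z))%:E).
  apply/measurable_EFinP; exact: measurableT_comp mball (measurable_addmx m).
rewrite (integral_orthonormal_rows AA mballX) (ball_measure_sqnorm c (m' := theta)); last first.
  by rewrite m_eta.
apply/esym/fineK/integrable_fin_num => //; exact: integrable_inball.
Qed.

Lemma chi2_quantile_ge0 l (beta : R) : (0 <= chi2_quantile l beta)%E.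
Proof. by apply: le_ereal_inf_tmp => _ [x [x0 _] <-]; rewrite lee_fin. Qed.

End normal_laws.

Section pretest_estimator.
Context {R : realType}.

Lemma normal_law_factor p l (m : 'cV[R]_p) (U : 'M[R]_(p, l)) (mu : probability 'cV[R]_p R) :
  U^T *m U = 1%:M -> normal_law m (U *m U^T) mu ->
  forall f : 'cV[R]_p -> \bar R, measurable_fun setT f -> (forall x, 0 <= f x)%E ->
  (\int[mu]_x f x = \int[std_normal l]_z f (m + U *m z)%R)%E.
Proof.
move=> UU /normal_law_integral[k [A [AA muf]]] f mf f0; rewrite muf//.
have [AE BB] := same_gram_factor UU AA.
have mg : measurable_fun setT (fun z => f (m + U *m z)).
  exact: (measurableT_comp mf (measurableT_comp (measurable_addmx m) (measurable_mulmx U))).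
rewrite -(integral_orthonormal_rows BB mg).
by apply: eq_integral => z _; rewrite mulmxA -AE.
Qed.

(** * The pretest estimator with a finite critical value *)

Section fixed_projection.
Context (p n : nat) (S Q : 'M[R]_p) (U : 'M[R]_(p, n.+1)) (tau : 'cV[R]_p).
Context d (T : measurableType d) (P : probability T R) (D : {RV P >-> 'cV[R]_p}) (c : R).
Context (UU : U^T *m U = 1%:M) (UUQ : U *m U^T = Q) (Ssym : S^T = S).
Context (Dlaw : normal_law (Q *m S *m tau) Q (distribution P D)).

Let theta : 'cV[R]_n.+1 := U^T *m S *m tau.
Let a (i : 'I_p) : 'cV[R]_n.+1 := (row i (invmx S *m U))^T.
Let kappa : 'cV[R]_p := invmx S *m Q *m S *m tau.
Let est (x : 'cV[R]_p) : 'cV[R]_p := invmx S *m Q *m ((1 - inball c x) *: x - S *m tau).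
Let w (z : 'cV[R]_n.+1) : R := 1 - inball c (theta + z).

Let QU : Q *m U = U.
Proof. by rewrite -UUQ -mulmxA UU mulmx1. Qed.

Let Utheta : U *m theta = Q *m S *m tau.
Proof. by rewrite /theta !mulmxA UUQ. Qed.

Let sqnormU x : sqnorm (U *m x) = sqnorm x.
Proof. by rewrite !sqnorm_dotv dotv_mulmx mulmxA UU mul1mx. Qed.

Let dot_a i x : dotv (a i) x = (invmx S *m U *m x) i 0.
Proof. by rewrite /dotv /a trmxK -row_mul mxE. Qed.

Let a_theta i : dotv (a i) theta = kappa i 0.
Proof. by rewrite dot_a -mulmxA Utheta /kappa !mulmxA. Qed.

Let invSsym : (invmx S)^T = invmx S.
Proof. by rewrite trmx_inv Ssym. Qed.

Let a_a i j : dotv (a i) (a j) = (invmx S *m Q *m invmx S) i j.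
Proof.
have -> : invmx S *m Q *m invmx S = (invmx S *m U) *m (invmx S *m U)^T.
  by rewrite trmx_mul invSsym -UUQ !mulmxA.
rewrite dotvE /a; move: (invmx S *m U) => M; rewrite [RHS]mxE.
by apply: eq_bigr => k _; rewrite !mxE.
Qed.

Let est_entry i z : est (U *m (theta + z)) i 0 = w z * dotv (a i) (theta + z) - kappa i 0.
Proof.
rewrite /est /inball sqnormU mulmxBr mxE -scalemxAr mxE !mulmxA.
rewrite -[invmx S *m Q *m U]mulmxA QU -dot_a /w /inball; congr (_ + _).
by rewrite mxE.
Qed.

Let measurable_est i : measurable_fun setT (fun x => est x i 0).
Proof.
apply: measurableT_comp (measurable_mx_coor i 0) _.
apply: (measurableT_comp (measurable_mulmx _)).
apply/measurable_fun_mxP => k j; under eq_fun do rewrite !mxE.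
apply: measurable_funB => //; apply: measurable_funM; last exact: measurable_mx_coor.
by apply: measurable_funB => //; exact: measurable_inball.
Qed.

Let integral_D (f : 'cV[R]_p -> \bar R) : measurable_fun setT f ->
  (\int[P]_x f (D x) = \int[std_normal n.+1]_z f (U *m (theta + z))%R)%E.
Proof.
apply: (same_law_integral (phi1 := D) (phi2 := fun z => U *m (theta + z))) => g mg g0.
rewrite -(ge0_integral_distribution D mg g0).
move: Dlaw; rewrite -UUQ => /(normal_law_factor UU)/(_ g mg g0) ->.
by apply: eq_integral => z _; rewrite UUQ mulmxDr Utheta.
Qed.

Let gamma2 := ball_prob c (pad2 theta).
Let gamma4 := ball_prob c (pad2 (pad2 theta)).

Let integral_fine (f : 'cV[R]_n.+1 -> R) :
  (std_normal n.+1).-integrable setT (EFin \o f) ->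
  (\int[std_normal n.+1]_z (f z)%:E = (\int[std_normal n.+1]_z f z)%R%:E)%E.
Proof. by move=> fi; rewrite fineK//; exact: integrable_fin_num fi. Qed.

Lemma expectation_pretest i :
  expectation P (fun x => est (D x) i 0) = (- (gamma2 * kappa i 0))%:E.
Proof.
rewrite unlock (integral_D (f := fun x => (est x i 0)%:E)); last exact/measurable_EFinP.
have [wi _ wE _] := tail_moments c (a i) (a i) theta.
under eq_integral do rewrite est_entry.
have ki := integrableR_cst (std_normal n.+1) (- kappa i 0).
rewrite (integral_fine (integrableR_D wi ki)) RintegralD// wE Rintegral_prob_cst.
by rewrite a_theta; congr EFin; rewrite -/gamma2; ring.
Qed.

Lemma covariance_pretest i j :
  covariance P (fun x => est (D x) i 0) (fun x => est (D x) j 0) =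
  ((1 - gamma2) * (invmx S *m Q *m invmx S) i j +
   ((1 - gamma4) - (1 - gamma2) ^+ 2) * (kappa i 0 * kappa j 0))%:E.
Proof.
rewrite covariance.unlock !expectation_pretest expectation.unlock.
pose ki := (1 - gamma2) * kappa i 0; pose kj := (1 - gamma2) * kappa j 0.
pose f x := ((est x i 0 - - (gamma2 * kappa i 0)) * (est x j 0 - - (gamma2 * kappa j 0)))%:E.
have mf : measurable_fun setT f.
  apply/measurable_EFinP; apply: measurable_funM; exact: measurable_funB.
apply: (etrans (integral_D mf)).
have [wi wij wiE wijE] := tail_moments c (a i) (a j) theta.
have [wj _ wjE _] := tail_moments c (a j) (a i) theta.
(* The weight is an indicator, hence equal to its square: this turns the second
   moments of the estimator into moments outside the ball. *)
have ww z : w z * w z = w z.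
  by rewrite /w /inball; case: (sqnorm _ <= c); rewrite ?subrr ?mulr0 ?subr0 ?mulr1.
have fE z : f (U *m (theta + z)) =
    (w z * (dotv (a i) (theta + z) * dotv (a j) (theta + z)) +
     (- kj * (w z * dotv (a i) (theta + z)) +
      (- ki * (w z * dotv (a j) (theta + z)) + ki * kj)))%:E.
  rewrite /f !est_entry /ki /kj; congr EFin.
  by rewrite -[X in X * (_ * _) + _]ww; ring.
under eq_integral do rewrite fE.
have i1 := integrableR_Z (- kj) wi.
have i2 := integrableR_Z (- ki) wj.
have i3 := integrableR_cst (std_normal n.+1) (ki * kj).
have i23 := integrableR_D i2 i3.
have i123 := integrableR_D i1 i23.
rewrite (integral_fine (integrableR_D wij i123)).
rewrite !RintegralD// Rintegral_prob_cst !RintegralZl//.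
rewrite wijE wiE wjE !a_theta a_a -/gamma2 -/gamma4 /ki /kj; congr EFin; ring.
Qed.

End fixed_projection.
End pretest_estimator.

Theorem proposition1 (R : realType) (p r : nat) (hrp : (r < p)%N)
    (alpha : R) (halpha : 0 <= alpha <= 1)
    (Gamma S : 'M[R]_p) (hGamma : posdefmx Gamma) (hS : posdef_sqrt Gamma S)
    (Upsilon : 'M[R]_(p, r)) (hUpsilon : \rank Upsilon = r)
    (tau : 'cV[R]_p)
    (d : measure_display) (T : measurableType d) (P : probability T R)
    (D : {RV P >-> 'cV[R]_p})
    (hD : normal_law (Peff_perp Gamma S Upsilon *m S *m tau)
            (Peff_perp Gamma S Upsilon) (distribution P D))
    (d2 : measure_display) (T2 : measurableType d2) (P2 : probability T2 R)
    (V2 : {RV P2 >-> R})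
    (hV2 : noncentral_chi2_law (p - r + 2)%N
             ((tau^T *m S *m Peff_perp Gamma S Upsilon *m S *m tau) 0 0)
             (distribution P2 V2))
    (d4 : measure_display) (T4 : measurableType d4) (P4 : probability T4 R)
    (V4 : {RV P4 >-> R})
    (hV4 : noncentral_chi2_law (p - r + 4)%N
             ((tau^T *m S *m Peff_perp Gamma S Upsilon *m S *m tau) 0 0)
             (distribution P4 V4)) :
  let Pperp := Peff_perp Gamma S Upsilon in
  let q := chi2_quantile (p - r) (1 - alpha) in
  let gamma2 := fine (P2 [set w | ((V2 w)%:E <= q)%E]) in
  let gamma4 := fine (P4 [set w | ((V4 w)%:E <= q)%E]) in
  let mu := fun w => mu_PTE_eff alpha Gamma S Upsilon tau (D w) in
  mean_vector P mu =
    map_mx EFin (- (gamma2 *: (invmx S *m Pperp *m S *m tau))) /\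
  covariance_matrix P mu =
    map_mx EFin
      ((1 - gamma2) *: (invmx S *m Pperp *m invmx S) +
       ((1 - gamma4) - (1 - gamma2) ^+ 2) *:
         (invmx S *m Pperp *m S *m tau *m tau^T *m S *m Pperp *m invmx S)).
Proof.
move=> Pperp q gamma2 gamma4 mu.
have [n nE] : exists n, (p - r)%N = n.+1.
  by exists (p - r).-1; rewrite prednK// subn_gt0.
have [Qsym QQ trQ] := Peff_perp_projection (ltnW hrp) hGamma hS hUpsilon.
have Ssym : S^T = S by have [[]] := hS.
rewrite -/Pperp in Qsym QQ trQ hD hV2 hV4.
rewrite nE in trQ.
have [U [UU UUQ]] := orthogonal_projection_factor Qsym QQ trQ.
pose kappa := invmx S *m Pperp *m S *m tau.
have rank1 i j : (invmx S *m Pperp *m S *m tau *m tau^T *m S *m Pperp *m invmx S) i j =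
    kappa i 0 * kappa j 0.
  have -> : invmx S *m Pperp *m S *m tau *m tau^T *m S *m Pperp *m invmx S = kappa *m kappa^T.
    by rewrite /kappa !trmx_mul trmx_inv Ssym Qsym !mulmxA.
  by rewrite mxE big_ord_recl big_ord0 addr0 [X in _ * X]mxE.
have lincomb (k1 k2 : R) (A B : 'M[R]_p) i j :
    (k1 *: A + k2 *: B) i j = k1 * A i j + k2 * B i j.
  by rewrite !mxE.
have scaledN (k1 : R) (A : 'cV[R]_p) i j : (- (k1 *: A)) i j = - (k1 * A i j) by rewrite !mxE.
have q0 : (0 <= q)%E := chi2_quantile_ge0 _ _.
have pretestE v : pretest_indicator (p - r) alpha v = (v%:E <= q)%E%:R by [].
case qE : q q0 => [c| |] // _.
- pose theta := U^T *m S *m tau.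
  have theta_norm : sqnorm theta = (tau^T *m S *m Pperp *m S *m tau) 0 0.
    by rewrite sqnorm_dotv /dotv !trmx_mul trmxK Ssym -UUQ !mulmxA.
  have [g2 g4] : gamma2 = ball_prob c (pad2 theta) /\
      gamma4 = ball_prob c (pad2 (pad2 theta)).
    move: hV2 hV4; rewrite nE addn2 addn4 => hV2' hV4'.
    have gE d' (T' : measurableType d') (P' : probability T' R) (V : {RV P' >-> R}) :
        fine (P' [set x | ((V x)%:E <= q)%E]) =
        fine (distribution P' V [set x | x <= c]).
      by congr (fine (P' _)); apply/seteqP; split => x /=; rewrite qE lee_fin.
    rewrite /gamma2 /gamma4 !gE; split.
      by rewrite (noncentral_chi2_ball_prob c hV2' (theta := pad2 theta)) ?sqnorm_pad2.
    rewrite (noncentral_chi2_ball_prob c hV4' (theta := pad2 (pad2 theta)))//.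
    by rewrite !sqnorm_pad2.
  have muE i : (fun w => mu w i 0) = (fun w =>
      (invmx S *m Pperp *m ((1 - inball c (D w)) *: D w - S *m tau)) i 0).
    by apply/funext => w; rewrite /mu /mu_PTE_eff pretestE qE lee_fin.
  split.
    apply/matrixP => i j; rewrite [j]ord1 [LHS]mxE [RHS]mxE scaledN -/kappa g2.
    by rewrite muE (expectation_pretest c UU UUQ hD i).
  apply/matrixP => i j; rewrite [LHS]mxE [RHS]mxE lincomb rank1 !muE.
  by rewrite (covariance_pretest c UU UUQ Ssym hD i j) g2 g4.
(* an infinite critical value: the pretest always accepts, so that the
   estimator is constant *)
- have [g2 g4] : gamma2 = 1 /\ gamma4 = 1.
    have gE d' (T' : measurableType d') (P' : probability T' R) (V : {RV P' >-> R}) :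
        fine (P' [set x | ((V x)%:E <= q)%E]) = 1.
      rewrite qE (_ : [set _ | _] = setT); last by apply/seteqP; split => x //=; rewrite leey.
      exact: (congr1 fine (probability_setT P')).
    by rewrite /gamma2 /gamma4 !gE.
  have muE w : mu w = - kappa.
    rewrite /mu /mu_PTE_eff pretestE qE leey subrr scale0r sub0r mulmxN.
    by rewrite /kappa !mulmxA.
  split.
    apply/matrixP => i j; rewrite [j]ord1 [LHS]mxE [RHS]mxE scaledN -/kappa g2 mul1r.
    rewrite -[RHS](expectation_cst P).
    by congr expectation; apply/funext => w; rewrite muE mxE.
  apply/matrixP => i j; rewrite [LHS]mxE [RHS]mxE lincomb g2 g4.
  rewrite (_ : (fun w => mu w i 0) = cst (- kappa i 0)); last first.
    by apply/funext => w; rewrite muE mxE.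
  by rewrite covariance_cst_l subrr expr0n/= subrr !mul0r addr0.
Qed.
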